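(* Let $\mathcal{M}\subset\mathbb{R}^n$ be an algebraic constraint manifold, let $\pi_{\mathcal{H}}\propto e^{-U_{\mathcal H}}$ be a target probability density on $\mathcal{M}$ with respect to its surface (Hausdorff) measure, and consider the Metropolis-adjusted randomized time constrained HMC algorithm (described in the context) with maximal step size $\Delta t_{\max}>0$ and rate $\lambda>0$. Assume that the proposal map $\Psi$ is reversible for this $\Delta t_{\max}$, i.e. that for every duration $T>0$ the proposal map $\Psi_T:T\mathcal{M}\to T\mathcal{M}$ satisfies $\Psi_T\circ\Psi_T=\mathrm{id}$. Then the probability measure $$\mu(dz)\propto e^{-H(x,v)}\,\lambda_{T\mathcal{M}}(dz),\qquad z=(x,v)\in T\mathcal{M},\quad H(x,v)=U_{\mathcal H}(x)+\tfrac12 v^Tv,$$ where $\lambda_{T\mathcal{M}}$ is the Liouville measure on $T\mathcal{M}$, is invariant with respect to the one-iteration Markov kernel of the algorithm on $T\mathcal{M}$.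
   Context: Setting: $\mathcal{M}=\{x\in\mathbb{R}^n : c(x)=0\}$ with $c=(g_1,\dots,g_m)^T$ and Jacobian $C(x)=\partial c/\partial x$ of full rank for all $x\in\mathcal{M}$. $\mathcal{M}$ carries the metric induced from $\mathbb{R}^n$, and $T_x\mathcal{M}=\{v\in\mathbb{R}^n: C(x)v=0\}$. $\sigma_{\mathcal{M}}$ is the surface measure, and the Liouville measure on $T\mathcal{M}$ is $\lambda_{T\mathcal M}(dx\,dv)=\sigma_{\mathcal M}(dx)\,\sigma_{T_x\mathcal M}(dv)$ with $\sigma_{T_x\mathcal M}$ Lebesgue measure on $T_x\mathcal{M}$. $U_{\mathcal H}=-\log\pi_{\mathcal H}$ up to a constant, and $\int_{\mathcal M}e^{-U_{\mathcal H}}d\sigma_{\mathcal M}<\infty$. RATTLE step with step size $\Delta t$, $(x_n,v_n)\in T\mathcal{M}\mapsto(x_{n+1},v_{n+1})\in T\mathcal{M}$, with $U=U_{\mathcal H}$: $$v_{n+1/2}=v_n-\tfrac{\Delta t}{2}\nabla U(x_n)-\tfrac{\Delta t}{2}C(x_n)^T\lambda^n_{(r)},\quad x_{n+1}=x_n+\Delta t\,v_{n+1/2},\quad \text{s.t. } c(x_{n+1})=0,$$ $$v_{n+1}=v_{n+1/2}-\tfrac{\Delta t}{2}\nabla U(x_{n+1})-\tfrac{\Delta t}{2}C(x_{n+1})^T\lambda^{n+1}_{(v)},\quad\text{s.t. } C(x_{n+1})v_{n+1}=0,$$ where $\lambda^n_{(r)},\lambda^{n+1}_{(v)}\in\mathbb{R}^m$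 are Lagrange multipliers. $\Psi^L_{\Delta t}:T\mathcal M\to T\mathcal M$ denotes $L$ steps of RATTLE with step size $\Delta t$. It is taken as known (for $H\in C^2(T\mathcal M)$) that the RATTLE map is symplectic, hence $C^1$ and preserving $\lambda_{T\mathcal M}$. $N(x,v)=(x,-v)$. Proposal map: for $T>0$ put $L=\lceil T/\Delta t_{\max}\rceil$, $\Delta t=T/L$, and $\Psi_T(z)=\mathrm{Rev}(N(\Psi^L_{\Delta t}(z)))$. Here $\mathrm{Rev}$ is an optional reversibility check: either it is omitted (identity), or it replaces the proposal by the current state $z$ whenever applying $N\circ\Psi^L_{\Delta t}$ to the proposal does not return $z$. Algorithm, one iteration from $(x_{k-1},v_{k-1})$: (1) resample $v_{k-1}\sim\mathcal N(0,I\mid C(x_{k-1})v=0)$, the standard Gaussian on $T_{x_{k-1}}\mathcal M$. (2) Sample $T\sim\mathrm{Exp}(\lambda)$ (rate $\lambda$, independently), set $(x^*,v^* )=\Psi_T(x_{k-1},v_{k-1})$, and with probability $\min\{1,\exp(H(x_{k-1},v_{k-1})-H(x^*,v^* ))\}$ set $(x_k,v_k)=(x^*,v^* )$; otherwise set $(x_k,v_k)=(x_{k-1},v_{k-1})$. *)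

(* Defs.v *)
From HB Require Import structures.
From mathcomp Require Import all_boot all_order all_algebra.
From mathcomp Require Import all_classical all_reals all_analysis.
From mathcomp Require mpoly.

Set Implicit Arguments.
Unset Strict Implicit.
Unset Printing Implicit Defensive.

Import Order.TTheory GRing.Theory Num.Theory.
Import numFieldNormedType.Exports.

Local Open Scope classical_set_scope.
Local Open Scope ring_scope.

(* Matrices (in particular column vectors) carry their Borel sigma-algebra. *)
HB.instance Definition _ (R : realType) (m n : nat) :=
  @isMeasurable.Build (sigma_display (@open 'M[R]_(m, n))) 'M[R]_(m, n)
    <<s @open 'M[R]_(m, n) >>
    (@sigma_algebra0 _ setT _) (@sigma_algebraC _ _)
    (@sigma_algebra_bigcup _ setT _).

Section Measures.
Variable R : realType.

(* The norm of the library on matrices is the sup norm, hence this one. *)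
Definition sqnorm n (v : 'cV[R]_n) : R := (v^T *m v) 0 0.
Definition enorm n (v : 'cV[R]_n) : R := Num.sqrt (sqnorm v).

Definition ediam n (A : set 'cV[R]_n) : \bar R :=
  ereal_sup [set (enorm (p.1 - p.2))%:E | p in A `*` A].

(* Volume of the Euclidean unit ball of R^d: pi^(d/2) / Gamma(d/2 + 1). *)
Fixpoint ball_volume (d : nat) : R :=
  match d with
  | 0 => 1
  | 1 => 2
  | d'.+2 => 2 * pi / d%:R * ball_volume d'
  end.

(* Only used on sets of finite diameter; the case distinction matters for
   d = 0, where a nonempty set has weight 1. *)
Definition hausdorff_weight n (d : nat) (A : set 'cV[R]_n) : \bar R :=
  if A == set0 then 0%E else (ball_volume d * (fine (ediam A) / 2) ^+ d)%:E.

Definition hausdorff_pre n (d : nat) (delta : R) (A : set 'cV[R]_n) : \bar R :=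
  ereal_inf [set (\sum_(0 <= i <oo) hausdorff_weight d (F i))%E
    | F in [set F : nat -> set 'cV[R]_n |
        A `<=` \bigcup_i F i /\ forall i, (ediam (F i) <= delta%:E)%E]].

(* d-dimensional Hausdorff measure, normalized so as to extend Lebesgue
   measure; it is an outer measure, whose restriction to Borel sets is the
   only thing the integral sees. *)
Definition hausdorff n (d : nat) (A : set 'cV[R]_n) : \bar R :=
  ereal_sup [set hausdorff_pre d delta A | delta in [set delta : R | 0 < delta]].

Fixpoint lebesgue_cV (d : nat) : set 'cV[R]_d -> \bar R :=
  match d with
  | 0 => fun A => \d_(0 : 'cV[R]_0) A
  | d'.+1 => fun A => ((@lebesgue_measure R) \x (@lebesgue_cV d'))%E
      [set p | A (col_mx (p.1%:M : 'cV[R]_1) p.2)]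
  end.

End Measures.

Section Manifold.
Variables (R : realType) (n m : nat) (g : 'I_m -> mpoly.mpoly n R).

Definition constraint_manifold : set 'cV[R]_n :=
  [set x | forall i, mpoly.meval (fun j => x j 0) (g i) = 0].

Definition constraint_jacobian (x : 'cV[R]_n) : 'M[R]_(m, n) :=
  \matrix_(i, j) mpoly.meval (fun k => x k 0) (mpoly.mderiv j (g i)).

Definition tangent_space (x : 'cV[R]_n) : set 'cV[R]_n :=
  [set v | constraint_jacobian x *m v = 0].

Definition tangent_bundle : set ('cV[R]_n * 'cV[R]_n) :=
  [set z | constraint_manifold z.1 /\ tangent_space z.1 z.2].

Definition surface_measure : set 'cV[R]_n -> \bar R := @hausdorff R n (n - m).

(* An orthonormal basis of the tangent space, as the columns of a matrix.
   Which one is chosen is irrelevant below, as Lebesgue measure is invariant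
   under orthogonal maps. *)
Definition tangent_frame (x : 'cV[R]_n) : 'M[R]_(n, n - m) :=
  get [set Q : 'M[R]_(n, n - m) | constraint_jacobian x *m Q = 0 /\ Q^T *m Q = 1%:M].

Definition tangent_lebesgue (x : 'cV[R]_n) (B : set 'cV[R]_n) : \bar R :=
  lebesgue_cV [set w : 'cV[R]_(n - m) | B (tangent_frame x *m w)].

Definition liouville (A : set ('cV[R]_n * 'cV[R]_n)) : \bar R :=
  (\int[surface_measure]_(x in constraint_manifold)
     tangent_lebesgue x (xsection A x))%E.

Definition gaussian_density (v : 'cV[R]_n) : R :=
  (Num.sqrt (2 * pi) ^+ (n - m))^-1 * expR (- (sqnorm v / 2)).

(* The standard Gaussian distribution conditioned on the tangent space at x. *)
Definition tangent_gaussian (x : 'cV[R]_n) (B : set 'cV[R]_n) : \bar R :=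
  (\int[tangent_lebesgue x]_(v in B `&` tangent_space x)
     (gaussian_density v)%:E)%E.

Section Algorithm.
Variable U : 'cV[R]_n -> R.

Definition gradient (x : 'cV[R]_n) : 'cV[R]_n :=
  \col_i 'D_(delta_mx i 0 : 'cV[R]_n) (U : 'cV[R]_n -> R^o) x.

Definition hamiltonian (z : 'cV[R]_n * 'cV[R]_n) : R :=
  U z.1 + sqnorm z.2 / 2.

(* The multipliers are solutions of nonlinear equations which need not be
   unique, so one step is a relation; a RATTLE map is a function Phi with
   rattle_step dt z (Phi dt z). *)
Definition rattle_step (dt : R) (z z' : 'cV[R]_n * 'cV[R]_n) : Prop :=
  exists (vhalf : 'cV[R]_n) (lam_r lam_v : 'cV[R]_m),
    [/\ vhalf = z.2 - (dt / 2) *: gradient z.1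
                    - (dt / 2) *: ((constraint_jacobian z.1)^T *m lam_r),
        z'.1 = z.1 + dt *: vhalf,
        constraint_manifold z'.1,
        z'.2 = vhalf - (dt / 2) *: gradient z'.1
                     - (dt / 2) *: ((constraint_jacobian z'.1)^T *m lam_v)
      & constraint_jacobian z'.1 *m z'.2 = 0].

Definition momentum_flip (z : 'cV[R]_n * 'cV[R]_n) : 'cV[R]_n * 'cV[R]_n :=
  (z.1, - z.2).

(* For a C^1 symplectic map, which may fail to be injective, the change of
   variables formula gives preservation of volume in this form. *)
Definition liouville_preserving
    (f : 'cV[R]_n * 'cV[R]_n -> 'cV[R]_n * 'cV[R]_n) : Prop :=
  forall A B : set ('cV[R]_n * 'cV[R]_n),
    measurable A -> measurable B ->
    A `<=` tangent_bundle -> B `<=` tangent_bundle ->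
    set_bij A B f -> liouville A = liouville B.

Variables (Phi : R -> 'cV[R]_n * 'cV[R]_n -> 'cV[R]_n * 'cV[R]_n).
Variables (dt_max : R) (check : bool).

Definition nsteps (T : R) : nat := `|Num.ceil (T / dt_max)|%N.

Definition flipped_trajectory (T : R) (z : 'cV[R]_n * 'cV[R]_n) :=
  momentum_flip (iter (nsteps T) (Phi (T / (nsteps T)%:R)) z).

(* check tells whether the reversibility check is performed. *)
Definition proposal (T : R) (z : 'cV[R]_n * 'cV[R]_n) :=
  let z' := flipped_trajectory T z in
  if check && (flipped_trajectory T z' != z) then z else z'.

Definition accept_prob (z z' : 'cV[R]_n * 'cV[R]_n) : R :=
  Num.min 1 (expR (hamiltonian z - hamiltonian z')).

Variable rate : R.

Definition metropolis_kernel (z : 'cV[R]_n * 'cV[R]_n)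
    (A : set ('cV[R]_n * 'cV[R]_n)) : \bar R :=
  (\int[exponential_prob rate]_(T in `]0%R, +oo[)
     (let a := accept_prob z (proposal T z) in
      (a * \1_A (proposal T z) + (1 - a) * \1_A z)%R)%:E)%E.

Definition hmc_kernel (z : 'cV[R]_n * 'cV[R]_n)
    (A : set ('cV[R]_n * 'cV[R]_n)) : \bar R :=
  (\int[tangent_gaussian z.1]_(v in tangent_space z.1)
     metropolis_kernel (z.1, v) A)%E.

End Algorithm.

Definition canonical_weight (U : 'cV[R]_n -> R)
    (A : set ('cV[R]_n * 'cV[R]_n)) : \bar R :=
  (\int[liouville]_(z in A `&` tangent_bundle)
     (expR (- hamiltonian U z))%:E)%E.

End Manifold.

(* Main.v *)
(* Hausdorff measure is a Borel measure because half-spaces are Caratheodory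
   measurable, and translation-invariant measures are multiples of Lebesgue
   measure, so the Liouville measure is a mixture of the Lebesgue measures of the
   tangent spaces and integrals against it disintegrate over the manifold.
   Resampling the velocity leaves the canonical measure invariant since the
   Gaussian is its conditional distribution given the position.  For a fixed
   duration T the proposal is a volume-preserving involution of the tangent
   bundle, because each RATTLE step is injective with measurable inverse on the
   set where N o Psi^L is an involution; hence
     e^(-H(z)) min(1, e^(H(z) - H(F z))) = min(e^(-H(z)), e^(-H(F z)))
   is invariant under F, which is detailed balance.  Tonelli then averages over T. *)
Require Import Defs.
From HB Require Import structures.
From mathcomp Require Import all_boot all_order all_algebra.
From mathcomp Require Import all_classical all_reals all_analysis.
From mathcomp Require Import measurable_realfun ring lra.
From mathcomp Require mpoly.
Set Implicit Arguments.
Unset Strict Implicit.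
Unset Printing Implicit Defensive.
Import Order.TTheory GRing.Theory Num.Theory.
Import numFieldNormedType.Exports.
Local Open Scope classical_set_scope.
Local Open Scope ring_scope.

(** Most measures of the statement are bare set functions, so each has to be identified with a
    bundled measure before any integral against it can be manipulated. Three obstacles shape the
    work. The surface measure is a Hausdorff measure on the whole of ['cV[R]_n], which is not
    sigma-finite in lower dimension; product measures are out of reach for it, and its integrals are
    handled by monotone convergence alone. Tonelli's theorem is applied only between sigma-finite
    factors, at the end between the normalized target and the law of the durations. Next,
    [tangent_frame] is an arbitrary choice without any regularity in the base point; only the
    orthogonal projector onto the tangent space depends measurably on it, and Lebesgue measure of
    the tangent space must be expressed through that projector. Finally, volume preservation is
    assumed between measurable sets in bijection, while a measurable map need not send measurable
    sets to measurable sets; reversibility is what provides an explicit inverse, so that images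
    along a trajectory become preimages. *)

(** * Borel measurability of matrix-valued maps *)

Section MatrixMeasurability.
Variable R : realType.

Lemma open_mx_entry m n (i : 'I_m) (j : 'I_n) (A : set R) : open A ->
  open [set M : 'M[R]_(m, n) | A (M i j)].
Proof.
move=> oA; rewrite openE => M /= Mab.
exists (fun i' j' => if (i' == i) && (j' == j) then A else setT).
  move=> i' j'; case: ifPn => [/andP[/eqP-> /eqP->]|_]; last exact: filterT.
  exact: open_nbhs_nbhs.
by move=> N /(_ i j); rewrite !eqxx.
Qed.

Lemma measurable_mx_entry m n (i : 'I_m) (j : 'I_n) :
  measurable_fun setT (fun M : 'M[R]_(m, n) => M i j).
Proof.
apply: (measurability _ (RGenOpens.measurableE R)).
move=> _ [_ [a [b ->] <-]]; rewrite setTI; apply: sub_sigma_algebra.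
exact/open_mx_entry/interval_open.
Qed.

(** Sup-norm balls with rational centre and radius, a countable base: arbitrary open sets become
    countable unions of them, which reduces measurability of a matrix-valued map to that of its
    entries. *)
Definition rat_box m n (p : 'M[rat]_(m, n) * rat) : set 'M[R]_(m, n) :=
  [set M | forall i j, `|ratr (p.1 i j) - M i j| < ratr p.2].

Lemma open_bigcup_rat_box m n (O : set 'M[R]_(m, n)) : open O ->
  O = \bigcup_(p in [set p | rat_box p `<=` O]) rat_box p.
Proof.
move=> oO; apply/seteqP; split=> [M OM|M [p /= pO pM]]; last exact: pO.
have /nbhs_ballP[e /= e0 eO] : nbhs M O by exact: open_nbhs_nbhs.
(* Half of [e], because the centre lies within [r] of [M] and [N] within [r] of the centre. *)
have [r] := rat_in_itvoo (divr_gt0 e0 (ltr0n R 2)).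
rewrite in_itv/= => /andP[r0 re].
have hq i j : {q : rat | `|ratr q - M i j| < ratr r :> R}.
  apply: cid; have : M i j - ratr r < M i j + ratr r by lra.
  move=> /rat_in_itvoo[q]; rewrite in_itv/= => /andP[q1 q2].
  by exists q; rewrite ltr_norml; apply/andP; split; lra.
exists (\matrix_(i, j) sval (hq i j), r) => /=; last first.
  by move=> i j /=; rewrite mxE; exact: (svalP (hq i j)).
move=> N /= hN; apply: eO; split => // i j.
have := hN i j; rewrite mxE; have := svalP (hq i j).
move: (sval _) => q qM qN; rewrite /ball/=.
have -> : M i j - N i j = (ratr q - N i j) - (ratr q - M i j) by ring.
by apply: le_lt_trans (ler_normB _ _) _; lra.
Qed.

Lemma measurable_rat_box d (T : measurableType d) (D : set T) m n
    (f : T -> 'M[R]_(m, n)) p : measurable D ->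
  (forall i j, measurable_fun D (fun t => f t i j)) ->
  measurable (D `&` f @^-1` rat_box p).
Proof.
move=> mD mf.
have -> : D `&` f @^-1` rat_box p = D `&`
    \bigcap_(i in setT) \bigcap_(j in setT) (D `&` (fun t => f t i j) @^-1`
       [set x : R | `|ratr (p.1 i j) - x| < ratr p.2]).
  apply/seteqP; split=> [t [Dt pt]|t [Dt pt]]; split=> // i.
    by move=> _ j _; split => //; exact: pt.
  by move=> j; have [] := pt i I j I.
apply: measurableI => //; apply: fin_bigcap_measurable => // i _.
apply: fin_bigcap_measurable => // j _.
by apply: mf => //; exact: measurable_ball.
Qed.

Lemma measurable_mx d (T : measurableType d) (D : set T) m n
    (f : T -> 'M[R]_(m, n)) :
  (forall i j, measurable_fun D (fun t => f t i j)) -> measurable_fun D f.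
Proof.
move=> mf mD; suff : measurable_fun D f by exact.
apply: (measurability (@open 'M[R]_(m, n))) => // _ [V oV <-].
rewrite (open_bigcup_rat_box oV) preimage_bigcup setI_bigcupr bigcup_mkcond.
apply: countable_bigcupT_measurable => [|p]; first exact: countableP.
by case: ifP => // _; exact: measurable_rat_box.
Qed.

Lemma measurable_mxE d (T : measurableType d) (D : set T) m n
    (f : T -> 'M[R]_(m, n)) i j : measurable_fun D f ->
  measurable_fun D (fun t => f t i j).
Proof. by move=> mf; exact: (measurableT_comp (measurable_mx_entry i j) mf). Qed.

Lemma measurable_mulmx d (T : measurableType d) (D : set T) m n p
    (f : T -> 'M[R]_(m, n)) (g : T -> 'M[R]_(n, p)) :
  measurable_fun D f -> measurable_fun D g ->
  measurable_fun D (fun t => f t *m g t).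
Proof.
move=> mf mg; apply: measurable_mx => i j.
under eq_fun do rewrite mxE.
by apply: measurable_sum => k; apply: measurable_funM; exact: measurable_mxE.
Qed.

Lemma measurable_trmx d (T : measurableType d) (D : set T) m n
    (f : T -> 'M[R]_(m, n)) :
  measurable_fun D f -> measurable_fun D (fun t => (f t)^T).
Proof.
move=> mf; apply: measurable_mx => i j; under eq_fun do rewrite mxE.
exact: measurable_mxE.
Qed.

Lemma measurable_mxD d (T : measurableType d) (D : set T) m n
    (f g : T -> 'M[R]_(m, n)) : measurable_fun D f -> measurable_fun D g ->
  measurable_fun D (fun t => f t + g t).
Proof.
move=> mf mg; apply: measurable_mx => i j; under eq_fun do rewrite mxE.
by apply: measurable_funD; exact: measurable_mxE.
Qed.

Lemma measurable_mxN d (T : measurableType d) (D : set T) m n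
    (f : T -> 'M[R]_(m, n)) : measurable_fun D f ->
  measurable_fun D (fun t => - f t).
Proof.
move=> mf; apply: measurable_mx => i j; under eq_fun do rewrite mxE.
by apply: measurableT_comp => //; exact: measurable_mxE.
Qed.

Lemma measurable_mxB d (T : measurableType d) (D : set T) m n
    (f g : T -> 'M[R]_(m, n)) : measurable_fun D f -> measurable_fun D g ->
  measurable_fun D (fun t => f t - g t).
Proof. by move=> mf mg; apply: measurable_mxD => //; exact: measurable_mxN. Qed.

Lemma measurable_mxZ d (T : measurableType d) (D : set T) m n
    (a : T -> R) (f : T -> 'M[R]_(m, n)) :
  measurable_fun D a -> measurable_fun D f ->
  measurable_fun D (fun t => a t *: f t).
Proof.
move=> ma mf; apply: measurable_mx => i j; under eq_fun do rewrite mxE.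
by apply: measurable_funM => //; exact: measurable_mxE.
Qed.

Lemma measurable_invr : measurable_fun setT (fun x : R => x^-1).
Proof.
(* [powR_inv1] asks for a nonnegative base, hence the square; at 0 both sides are 0. *)
have -> : (fun x : R => x^-1) = (fun x => x * ((x ^+ 2) `^ (-1))).
  apply/funext => x; rewrite powR_inv1 ?sqr_ge0//.
  by have [->|x0] := eqVneq x 0; [rewrite invr0 mul0r|field].
apply: measurable_funM => //.
exact: measurableT_comp (@measurable_powR R (-1)) (exprn_measurable 2).
Qed.

Lemma measurable_det d (T : measurableType d) (D : set T) n
    (f : T -> 'M[R]_n) : measurable_fun D f ->
  measurable_fun D (fun t => \det (f t)).
Proof.
move=> mf; rewrite /determinant; apply: measurable_sum => s.
apply: measurable_funM => //; apply: measurable_prod => i _.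
exact: measurable_mxE.
Qed.

Lemma measurable_adjugate d (T : measurableType d) (D : set T) n
    (f : T -> 'M[R]_n) : measurable_fun D f ->
  measurable_fun D (fun t => \adj (f t)).
Proof.
move=> mf; apply: measurable_mx => i j; under eq_fun do rewrite mxE.
apply: measurable_funM => //; apply: measurable_det.
apply: measurable_mx => k l; under eq_fun do rewrite !mxE.
exact: measurable_mxE.
Qed.

Lemma measurable_sqnorm d (T : measurableType d) (D : set T) n
    (f : T -> 'cV[R]_n) : measurable_fun D f ->
  measurable_fun D (fun t => sqnorm (f t)).
Proof.
move=> mf; apply: measurable_mxE; apply: measurable_mulmx => //.
exact: measurable_trmx.
Qed.

Lemma measurable_meval n (p : mpoly.mpoly n R) :
  measurable_fun setT (fun x : 'cV[R]_n => mpoly.meval (fun k => x k 0) p).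
Proof.
under eq_fun do rewrite mpoly.mevalE.
apply: measurable_sum => k; apply: measurable_funM => //.
apply: measurable_prod => i _; apply: measurable_funX.
exact: measurable_mx_entry.
Qed.

Lemma open_setC0_mx m n : open (~` [set (0 : 'M[R]_(m, n))]).
Proof.
rewrite openE => M /= M0.
have [i [j Mij0]] : exists i j, M i j <> 0.
  apply: contrapT => H; apply: M0; apply/matrixP => i j; rewrite mxE.
  by apply: contrapT => Mij; apply: H; exists i, j.
have : nbhs M [set N : 'M[R]_(m,n) | (~` [set 0]) (N i j)].
  apply: open_nbhs_nbhs; split => //.
  by apply: open_mx_entry; exact: closed_openC.
by apply: filterS => N /=; apply: contra_not => ->; rewrite mxE.
Qed.

Lemma measurable_eq_mx d (T : measurableType d) (D : set T) m n
    (f g : T -> 'M[R]_(m, n)) : measurable D ->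
  measurable_fun D f -> measurable_fun D g ->
  measurable (D `&` [set t | f t = g t]).
Proof.
move=> mD mf mg.
have -> : D `&` [set t | f t = g t] = D `&` (fun t => f t - g t) @^-1` [set 0].
  apply/seteqP; split=> t [Dt] /= => [->|/subr0_eq]; split=> //=.
  by rewrite subrr.
apply: measurable_mxB => //.
rewrite -[X in measurable X]setCK; apply: measurableC; apply: sub_sigma_algebra.
exact: open_setC0_mx.
Qed.

End MatrixMeasurability.

(** * Hausdorff measure as a Borel measure *)

Section HausdorffMeasure.
Variables (R : realType) (n d : nat).
Implicit Types A B : set 'cV[R]_n.

Lemma sqnormE k (v : 'cV[R]_k) : sqnorm v = \sum_i v i 0 ^+ 2.
Proof. by rewrite /sqnorm mxE; apply: eq_bigr => i _; rewrite mxE expr2. Qed.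

Lemma sqnorm_ge0 k (v : 'cV[R]_k) : 0 <= sqnorm v.
Proof. by rewrite sqnormE sumr_ge0// => i _; exact: sqr_ge0. Qed.

Lemma normr_le_enorm k (v : 'cV[R]_k) i : `|v i 0| <= enorm v.
Proof.
rewrite -sqrtr_sqr ler_wsqrtr// sqnormE (bigD1 i)//= lerDl.
by rewrite sumr_ge0// => j _; exact: sqr_ge0.
Qed.

Lemma ball_volume_ge0 k : 0 <= ball_volume R k.
Proof.
suff : 0 <= ball_volume R k /\ 0 <= ball_volume R k.+1 by case.
elim: k => [|k [h0 h1]]; split => //=.
by rewrite mulr_ge0// divr_ge0// mulr_ge0// pi_ge0.
Qed.

Lemma ediam_ge0 A : A !=set0 -> (0 <= ediam A)%E.
Proof.
move=> [x Ax]; apply: ereal_sup_ubound; exists (x, x) => //=.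
by rewrite subrr /enorm sqnormE big1 ?sqrtr0// => i _; rewrite mxE expr0n.
Qed.

Lemma hausdorff_weight_ge0 A : (0 <= hausdorff_weight d A)%E.
Proof.
rewrite /hausdorff_weight; case: ifPn => // /set0P/ediam_ge0 A0.
rewrite lee_fin mulr_ge0 ?ball_volume_ge0// exprn_ge0// divr_ge0//.
exact: fine_ge0.
Qed.

Lemma hausdorff_weight0 : hausdorff_weight d (set0 : set 'cV[R]_n) = 0%E.
Proof. by rewrite /hausdorff_weight eqxx. Qed.

Lemma ediam0 : ediam (set0 : set 'cV[R]_n) = -oo%E.
Proof.
rewrite /ediam (_ : [set _ | _ in _] = set0) ?ereal_sup0//.
by apply/seteqP; split => // _ [p [[]]].
Qed.

Lemma hausdorff_pre_ge0 delta A : (0 <= hausdorff_pre d delta A)%E.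
Proof.
apply: le_ereal_inf_tmp => _ [F _ <-].
by apply: nneseries_ge0 => *; exact: hausdorff_weight_ge0.
Qed.

Lemma le_hausdorff_pre delta A B : A `<=` B ->
  (hausdorff_pre d delta A <= hausdorff_pre d delta B)%E.
Proof.
move=> AB; apply/ereal_inf_le_tmp => _ [F [BF Fd] <-].
by exists F => //; split => //; exact: subset_trans BF.
Qed.

Lemma hausdorff_pre_nonincreasing delta delta' A : delta <= delta' ->
  (hausdorff_pre d delta' A <= hausdorff_pre d delta A)%E.
Proof.
move=> dd; apply/ereal_inf_le_tmp => _ [F [BF Fd] <-].
by exists F => //; split => // i; rewrite (le_trans (Fd i)).
Qed.

Lemma hausdorff_pre0 delta : hausdorff_pre d delta (set0 : set 'cV[R]_n) = 0%E.
Proof.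
apply/eqP; rewrite eq_le hausdorff_pre_ge0 andbT; apply: ereal_inf_lbound.
exists (fun=> set0); first by split=> [//|i]; rewrite ediam0 leNye.
by rewrite eseries0// => i _ _; exact: hausdorff_weight0.
Qed.

Lemma hausdorff_pre_le delta A : 0 < delta ->
  (hausdorff_pre d delta A <= hausdorff d A)%E.
Proof. by move=> d0; apply: ereal_sup_ubound; exists delta. Qed.

Lemma hausdorff_ge0 A : (0 <= hausdorff d A)%E.
Proof. by rewrite (le_trans _ (hausdorff_pre_le _ ltr01))// hausdorff_pre_ge0. Qed.

Lemma hausdorff0 : hausdorff d (set0 : set 'cV[R]_n) = 0%E.
Proof.
apply/eqP; rewrite eq_le hausdorff_ge0 andbT; apply: ge_ereal_sup => _ [e _ <-].
by rewrite hausdorff_pre0.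
Qed.

Lemma le_hausdorff : {homo @hausdorff R n d : A B / A `<=` B >-> (A <= B)%E}.
Proof.
move=> A B AB; apply: ge_ereal_sup => _ [e e0 <-].
by rewrite (le_trans (le_hausdorff_pre e AB))// hausdorff_pre_le.
Qed.

(* All sets are measurable in this copy, so that the outer measure generated
   by covers with measurable sets allows arbitrary covers. *)
Definition discrete_cV := 'cV[R]_n.
HB.instance Definition _ := Pointed.on discrete_cV.
HB.instance Definition _ := @isMeasurable.Build default_measure_display
  discrete_cV [set: set discrete_cV] I (fun _ _ => I) (fun _ _ => I).

(** The bound on diameters moves from the admissible covers into the weight, as an infinite price;
    [hausdorff_pre] then becomes an outer measure of the form [mu_ext]. *)
Definition small_weight (delta : R) (A : set discrete_cV) : \bar R :=
  if (ediam (A : set 'cV[R]_n) <= delta%:E)%E then hausdorff_weight d A else +oo%E.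

Lemma small_weight_ge0 delta A : (0 <= small_weight delta A)%E.
Proof. by rewrite /small_weight; case: ifP => // _; exact: hausdorff_weight_ge0. Qed.

Lemma hausdorff_preE delta A :
  hausdorff_pre d delta A = mu_ext (small_weight delta) A.
Proof.
apply/eqP; rewrite eq_le; apply/andP; split.
  apply: le_ereal_inf_tmp => _ [F [_ AF] <-].
  have [Fd|/existsNP[i /negP Fi]] := pselect (forall i, (ediam (F i : set 'cV[R]_n) <= delta%:E)%E).
    apply: ereal_inf_lbound; exists F => //; apply: eq_eseriesr => i _.
    by rewrite /small_weight Fd.
  rewrite (@nneseries_pinfty _ _ xpredT i) ?leey// => [k _|].
    exact: small_weight_ge0.
  by rewrite /small_weight (negbTE Fi).
apply: le_ereal_inf_tmp => _ [F [AF Fd] <-].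
apply: ereal_inf_lbound; exists F; first by split.
by apply: eq_eseriesr => i _; rewrite /small_weight Fd.
Qed.

Lemma hausdorff_sigma_subadditive : sigma_subadditive (@hausdorff R n d).
Proof.
move=> F; apply: ge_ereal_sup => _ [e e0 <-].
rewrite hausdorff_preE.
have := @mu_ext_sigma_subadditive _ discrete_cV R (small_weight e) (small_weight_ge0 e) F.
move/le_trans; apply.
apply: lee_nneseries => [i _ _|i _].
  exact/mu_ext_ge0/small_weight_ge0.
by rewrite -hausdorff_preE hausdorff_pre_le.
Qed.

HB.instance Definition _ := isOuterMeasure.Build R 'cV[R]_n (@hausdorff R n d)
  hausdorff0 hausdorff_ge0 le_hausdorff hausdorff_sigma_subadditive.

(** A set of diameter at most [delta < e] cannot meet both [A] and [B]. In a cover of the union,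
    [G C] keeps the members that meet [C] and empties the others, so each member is paid for at most
    once. *)
Lemma hausdorff_pre_separated (f : 'cV[R]_n -> R) (e delta : R) A B :
  (forall x y, `|f x - f y| <= enorm (x - y)) -> delta < e ->
  (forall x y, A x -> B y -> f x + e <= f y) ->
  (hausdorff_pre d delta A + hausdorff_pre d delta B <=
     hausdorff_pre d delta (A `|` B))%E.
Proof.
move=> lipf de sep; apply: le_ereal_inf_tmp => _ [F [ABF Fd] <-].
pose G C i := if `[< F i `&` C !=set0 >] then F i else set0.
have GC C : C `<=` A `|` B ->
    (hausdorff_pre d delta C <= \sum_(0 <= i <oo) hausdorff_weight d (G C i))%E.
  move=> CAB; apply: ereal_inf_lbound; exists (G C) => //; split=> [x Cx|i].
    have [i _ Fix] := ABF x (CAB x Cx); exists i => //; rewrite /G; case: asboolP => //.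
    by case; exists x.
  by rewrite /G; case: asboolP => // _; rewrite ediam0 leNye.
apply: le_trans (leeD (GC A _) (GC B _)) _; [exact: subsetUl|exact: subsetUr|].
rewrite -nneseriesD; [|by move=> *; exact: hausdorff_weight_ge0..].
apply: lee_nneseries => [i _ _|i _].
  by rewrite adde_ge0// hausdorff_weight_ge0.
rewrite /G; case: asboolP => [[a [Fa Aa]]|_]; last first.
  by rewrite hausdorff_weight0 add0e; case: asboolP => // _;
    rewrite hausdorff_weight0 hausdorff_weight_ge0.
case: asboolP => [[b [Fb Bb]]|_]; last by rewrite hausdorff_weight0 adde0.
have : (enorm (a - b) <= delta).
  rewrite -lee_fin; apply: le_trans (Fd i); apply: ereal_sup_ubound.
  by exists (a, b).
move=> /(le_trans (lipf a b)); rewrite ler_norml => /andP[].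
by move=> h1 h2; exfalso; have := sep _ _ Aa Bb; lra.
Qed.

Lemma hausdorff_separated (f : 'cV[R]_n -> R) (e : R) A B :
  (forall x y, `|f x - f y| <= enorm (x - y)) -> 0 < e ->
  (forall x y, A x -> B y -> f x + e <= f y) ->
  (hausdorff d A + hausdorff d B <= hausdorff d (A `|` B))%E.
Proof.
move=> lipf e0 sep.
have [->|ABoo] := eqVneq (hausdorff d (A `|` B)) +oo%E; first exact: leey.
have fAB : hausdorff d (A `|` B) \is a fin_num.
  by rewrite ge0_fin_numE ?hausdorff_ge0// ltey.
(* The two suprema over scales are taken one after the other. The scale [dl] serves both, as the
   pre-measures grow when the scale shrinks, and lies below the gap [e]. *)
have key d1 d2 : 0 < d1 -> 0 < d2 ->
    (hausdorff_pre d d1 A + hausdorff_pre d d2 B <= hausdorff d (A `|` B))%E.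
  move=> d10 d20; pose dl := Num.min (Num.min d1 d2) (e / 2).
  have dl0 : 0 < dl by rewrite !lt_min d10 d20 divr_gt0.
  have dle : dl < e by rewrite gt_min; apply/orP; right; lra.
  apply: le_trans (hausdorff_pre_le _ dl0).
  apply: le_trans (hausdorff_pre_separated lipf dle sep).
  by apply: leeD; apply: hausdorff_pre_nonincreasing; rewrite !ge_min lexx ?orbT.
have fB d2 : 0 < d2 -> hausdorff_pre d d2 B \is a fin_num.
  move=> d20; rewrite ge0_fin_numE ?hausdorff_pre_ge0//.
  rewrite (le_lt_trans _ (_ : hausdorff d (A `|` B) < +oo)%E) ?ltey//.
  rewrite (le_trans (hausdorff_pre_le _ d20))//.
  exact/le_hausdorff/subsetUr.
have fA : hausdorff d A \is a fin_num.
  rewrite ge0_fin_numE ?hausdorff_ge0//.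
  rewrite (le_lt_trans _ (_ : hausdorff d (A `|` B) < +oo)%E) ?ltey//.
  exact/le_hausdorff/subsetUl.
rewrite addeC -leeBrDr//; apply: ge_ereal_sup => _ [d2 d20 <-].
rewrite leeBrDr// addeC -leeBrDr ?fB//; apply: ge_ereal_sup => _ [d1 d10 <-].
by rewrite leeBrDr ?fB// key.
Qed.

(* The rings [t_k <= f < t_(k+1)] with t_k increasing to t have summable
   measures since those of indices k and k + 2 are at positive distance. *)
Lemma caratheodory_sublevel (f : 'cV[R]_n -> R) (t : R) :
  (forall x y, `|f x - f y| <= enorm (x - y)) ->
  (@hausdorff R n d).-caratheodory [set x | f x < t].
Proof.
move=> lipf; apply: le_caratheodory_measurable => X /=.
have [->|Xoo] := eqVneq (hausdorff d X) +oo%E; first exact: leey.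
pose u k : R := t - k.+1%:R^-1.
have u_lt k l : (k < l)%N -> u k < u l.
  by move=> kl; rewrite /u ltrD2l ltrN2 ltf_pV2 ?posrE// ltr_nat.
have u_lt_t k : u k < t by rewrite /u ltrBlDr ltrDl invr_gt0.
pose D k := X `&` [set x | f x < u k].
pose Rg k := X `&` [set x | u k.+1 <= f x < u k.+2].
have sep A B s s' : s < s' -> A `<=` X `&` [set x | f x < s] ->
    B `<=` X `&` [set x | s' <= f x] ->
    (hausdorff d A + hausdorff d B <= hausdorff d (A `|` B))%E.
  move=> ss' As Bs'; apply: (@hausdorff_separated f (s' - s)); rewrite ?subr_gt0//.
  by move=> x y /As[_ /= fx] /Bs'[_ /= fy]; lra.
(* Both parity classes at once: [D k] and [Rg k] are separated and their union lies in [D k.+2], so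
   the partial sums never exceed twice the measure of [X]. *)
have sum_rings k : (\sum_(0 <= i < k) hausdorff d (Rg i) <=
    hausdorff d (D k.+1) + hausdorff d (D k))%E.
  elim: k => [|k IH]; first by rewrite big_nil adde_ge0// hausdorff_ge0.
  rewrite big_nat_recr//=; apply: le_trans (leeD IH (lexx _)) _.
  rewrite -addeA addeC leeD2r//.
  apply: le_trans (sep (D k) (Rg k) (u k) (u k.+1) _ _ _) _ => //.
  - exact: u_lt.
  - by move=> x [Xx /andP[]].
  - apply: le_hausdorff => x [[Xx fx]|[Xx /andP[_ fx]]]; split => //=.
    by rewrite (lt_trans fx)// u_lt// leqW.
have DX k : (hausdorff d (D k) <= hausdorff d X)%E by apply: le_hausdorff; exact: subIsetl.
have Rg_lty : (\sum_(0 <= i <oo) hausdorff d (Rg i) < +oo)%E.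
  apply: (@le_lt_trans _ _ (hausdorff d X + hausdorff d X)%E); last first.
    by rewrite lte_add_pinfty// ltey.
  apply: lime_le; first by apply: is_cvg_nneseries => *; exact: hausdorff_ge0.
  by apply: nearW => k; apply: le_trans (sum_rings k) _; exact: leeD.
have tail0 := nneseries_tail_cvg Rg_lty (fun k _ => hausdorff_ge0 (Rg k)).
have main N : (hausdorff d (X `&` [set x | f x < t]%R) +
    hausdorff d (X `&` ~` [set x | f x < t]%R) <=
    hausdorff d X + \sum_(N <= i <oo) hausdorff d (Rg i))%E.
  apply: (@le_trans _ _ ((hausdorff d (D N.+1) + \sum_(N <= i <oo) hausdorff d (Rg i)) +
     hausdorff d (X `&` ~` [set x | f x < t]%R))%E).
    rewrite leeD2r//.
    have tl := outer_measure_sigma_subadditive_tail (@hausdorff R n d) N Rg.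
    rewrite /= in tl; apply: (le_trans _ (leeD (lexx (hausdorff d (D N.+1))) tl)).
    apply: (le_trans _ (outer_measureU2 (@hausdorff R n d) _ _)) => /=.
    apply: le_hausdorff => x [Xx /= fxt].
    have [fxN|Nfx] := ltP (f x) (u N.+1); [by left|right].
    have exk : exists k, f x < u k.
      exists (Num.trunc (t - f x)^-1); rewrite /u ltrBrDr addrC -ltrBrDr.
      by rewrite invf_plt ?posrE ?subr_gt0// truncnS_gt.
    case: (ex_minnP exk) => k fxk kmin.
    have Nk : (N.+1 < k)%N.
      rewrite ltnNge; apply/negP => kN; have ukN : u k <= u N.+1.
        by move: kN; rewrite leq_eqVlt => /orP[/eqP->//|/u_lt/ltW].
      by have := lt_le_trans fxk (le_trans ukN Nfx); rewrite ltxx.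
    (* The least index with [f x] below [u] exceeds [N.+1], hence is at least 2. Ring [k] runs from
       [u k.+1] to [u k.+2], so [x] lies in the ring two indices lower, which still belongs to the
       tail from [N]. *)
    case: k fxk kmin Nk => [//|[//|k]] fxk kmin Nk.
    exists k; first by apply/negP; rewrite -leqNgt.
    split => //=; rewrite fxk andbT leNgt.
    by apply/negP => /kmin; rewrite ltnn.
  rewrite -addeA (addeC (\sum_(_ <= _ <oo) _)%E) addeA leeD2r//.
  apply: le_trans (sep (D N.+1) (X `&` ~` [set x | f x < t]) (u N.+1) t _ _ _) _ => //.
  - by move=> x [Xx /negP]; rewrite -leNgt.
  - by apply: le_hausdorff => x [[]|[]].
have : (hausdorff d X + \sum_(N <= i <oo) hausdorff d (Rg i))%E @[N --> \oo] --> (hausdorff d X + 0)%E.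
  apply: cvgeD => //; last exact: cvg_cst.
  exact: fin_num_adde_defl.
rewrite adde0 => cv; rewrite -(cvg_lim _ cv)//.
by apply: lime_ge; [apply/cvg_ex; eexists; exact: cv|exact: nearW].
Qed.

Lemma caratheodory_open (O : set 'cV[R]_n) : open O ->
  (@hausdorff R n d).-caratheodory O.
Proof.
move=> oO.
have half (i : 'I_n) (t : R) : (@hausdorff R n d).-caratheodory [set x | x i 0 < t].
  apply: (@caratheodory_sublevel (fun x => x i 0)) => x y.
  by have := normr_le_enorm (x - y) i; rewrite !mxE.
have half' (i : 'I_n) (t : R) : (@hausdorff R n d).-caratheodory [set x | - x i 0 < t].
  apply: (@caratheodory_sublevel (fun x => - x i 0)) => x y.
  by have := normr_le_enorm (x - y) i; rewrite !mxE -opprD normrN.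
have box p : (@hausdorff R n d).-cara.-measurable (@rat_box R n 1 p).
  have -> : @rat_box R n 1 p = \bigcap_(i in [set: 'I_n])
      ([set x | x i 0 < ratr (p.1 i 0) + ratr p.2] `&`
       [set x | - x i 0 < ratr p.2 - ratr (p.1 i 0)]).
    apply/seteqP; split=> x px i.
      by move=> _; have := px i 0; rewrite ltr_norml => /andP[? ?]; split => /=; lra.
    by move=> j; rewrite ord1; have [] := px i I => /= ? ?; rewrite ltr_norml;
      apply/andP; split; lra.
  apply: fin_bigcap_measurable => // i _; apply: measurableI.
    exact: half.
  exact: half'.
rewrite (open_bigcup_rat_box oO) bigcup_mkcond.
suff : (@hausdorff R n d).-cara.-measurable (\bigcup_(i in setT) (fun p => if p \in
   [set p | @rat_box R n 1 p `<=` O] then @rat_box R n 1 p else set0) i) by [].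
apply: countable_bigcupT_measurable => [|p]; first exact: countableP.
by case: ifP.
Qed.

Lemma hausdorff_semi_sigma_additive :
  semi_sigma_additive (@hausdorff R n d : set 'cV[R]_n -> \bar R).
Proof.
have sub : (measurable : set (set 'cV[R]_n)) `<=` (@hausdorff R n d).-caratheodory.
  apply: smallest_sub; last by move=> A; exact: caratheodory_open.
  split; first exact: caratheodory_measurable_set0.
  - by move=> A; rewrite setTD; exact: caratheodory_measurable_setC.
  - exact: caratheodory_measurable_bigcup.
move=> F mF tF mUF; apply: (@caratheodory_measure_sigma_additive R _ (@hausdorff R n d)) => //.
- by move=> i; apply: sub; exact: mF.
- by apply: sub; exact: mUF.
Qed.

HB.instance Definition _ := isMeasure.Build _ _ _
  (@hausdorff R n d : set 'cV[R]_n -> \bar R)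
  hausdorff0 hausdorff_ge0 hausdorff_semi_sigma_additive.

End HausdorffMeasure.

HB.instance Definition _ (R : realType) (n m : nat) :=
  Measure.on (@surface_measure R n m).

(** * Image measures and aliases carrying sigma-finiteness *)

Section MeasureCopies.
Variables (R : realType) (d1 d2 : measure_display).
Variables (T1 : measurableType d1) (T2 : measurableType d2).

Definition image_measure (mu : {measure set T1 -> \bar R}) (f : T1 -> T2)
  (mf : measurable_fun setT f) : {measure set T2 -> \bar R}.
Proof. refine (pushforward mu f : {measure set T2 -> \bar R}); exact: mf. Defined.

(** An alias whose argument is the proof, so that a measure shown sigma-finite in the course of a
    proof can enter a product measure. *)
Definition sigma_finite_copy (mu : {measure set T1 -> \bar R})
  (sf : sigma_finite setT mu) : set T1 -> \bar R := mu.

HB.instance Definition _ (mu : {measure set T1 -> \bar R}) (sf : sigma_finite setT mu) :=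
  Measure.on (sigma_finite_copy sf).
HB.instance Definition _ (mu : {measure set T1 -> \bar R}) (sf : sigma_finite setT mu) :=
  Measure_isSigmaFinite.Build _ _ _ (sigma_finite_copy sf) sf.

End MeasureCopies.

(** * Lebesgue measure on column vectors: invariance, uniqueness, Gaussian integral *)

Section LebesgueMeasure.
Variable R : realType.

Definition cons_cV d (p : R * 'cV[R]_d) : 'cV[R]_d.+1 :=
  col_mx (p.1%:M : 'cV[R]_1) p.2.

Lemma cons_cV0 d (p : R * 'cV[R]_d) : cons_cV p 0 0 = p.1.
Proof.
by rewrite /cons_cV mxE; case: splitP => [j _|//]; rewrite mxE !ord1 eqxx mulr1n.
Qed.

Lemma cons_cVS d (p : R * 'cV[R]_d) (i : 'I_d) : cons_cV p (lift ord0 i) 0 = p.2 i 0.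
Proof.
rewrite /cons_cV mxE; case: splitP => [j|k] /=; first by rewrite ord1.
by case => /ord_inj ->.
Qed.

Lemma measurable_cons_cV d : measurable_fun setT (@cons_cV d).
Proof.
apply: measurable_mx => i j; rewrite ord1.
have [i' ->|->] := unliftP ord0 i.
  under eq_fun do rewrite cons_cVS.
  by apply: measurable_mxE; exact: measurable_snd.
under eq_fun do rewrite cons_cV0.
exact: measurable_fst.
Qed.

Lemma sqnorm_cons d (p : R * 'cV[R]_d) :
  sqnorm (cons_cV p) = p.1 ^+ 2 + sqnorm p.2.
Proof.
rewrite !sqnormE big_ord_recl cons_cV0; congr (_ + _).
by apply: eq_bigr => i _; rewrite cons_cVS.
Qed.

Lemma cons_cVD d (x y : R) (v w : 'cV[R]_d) :
  cons_cV (x, v) + cons_cV (y, w) = cons_cV (x + y, v + w).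
Proof.
apply/matrixP => i j; rewrite ord1 mxE.
have [i' ->|->] := unliftP ord0 i; first by rewrite !cons_cVS mxE.
by rewrite !cons_cV0.
Qed.

Lemma cons_cV_surj d (t : 'cV[R]_d.+1) : exists p, t = cons_cV p.
Proof.
exists (t 0 0, \col_i t (lift ord0 i) 0); apply/matrixP => i j; rewrite ord1.
have [i' ->|->] := unliftP ord0 i; first by rewrite cons_cVS mxE.
by rewrite cons_cV0.
Qed.

Definition cube d (r : R) : set 'cV[R]_d := [set v | forall i, `|v i 0| <= r].

Lemma measurable_cube d r : measurable (@cube d r).
Proof.
have -> : @cube d r = \bigcap_(i in [set: 'I_d])
    (setT `&` (fun v : 'cV[R]_d => v i 0) @^-1` `[- r, r]).
  apply/seteqP; split=> [v vr i _|v vr i].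
    by split => //=; rewrite in_itv/= -ler_norml.
  by have [_ /=] := vr i I; rewrite in_itv/= -ler_norml.
apply: fin_bigcap_measurable => // i _.
by apply: measurable_mx_entry => //; exact: measurable_itv.
Qed.

Lemma bigcup_cube d : \bigcup_k @cube d k%:R = setT.
Proof.
apply/seteqP; split => // v _.
pose f i := (Num.trunc `|v i 0|).+1; exists (\max_i f i)%N => // i.
rewrite (le_trans (ltW (truncnS_gt _)))// ler_nat.
exact: (leq_bigmax (F := f)).
Qed.

Lemma cons_cube d (r : R) : 0 <= r ->
  @cons_cV d @^-1` cube r = `[- r, r]%classic `*` cube r.
Proof.
move=> r0; apply/seteqP; split=> [p pr|p [/= p1 p2] i].
  split; first by have := pr 0; rewrite cons_cV0 /= in_itv/= -ler_norml.
  by move=> i; have := pr (lift ord0 i); rewrite cons_cVS.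
have [i' ->|->] := unliftP ord0 i; first by rewrite cons_cVS.
by rewrite cons_cV0 ler_norml; move: p1; rewrite in_itv.
Qed.

(** Both claims must be proved in a single induction: the product in dimension [d.+1] is a measure
    once the factor of dimension [d] is a sigma-finite one, and the values on cubes give
    sigma-finiteness. *)
Lemma lebesgue_cV_measure_cube d :
  exists2 mu : {measure set 'cV[R]_d -> \bar R},
    (mu : set _ -> \bar R) = @lebesgue_cV R d &
    forall r, 0 < r -> mu (cube r) = ((r *+ 2) ^+ d)%:E.
Proof.
elim: d => [|d [mu muE mur]].
  exists (\d_(0 : 'cV[R]_0)) => // r r0.
  by rewrite /= diracE mem_set// => -[].
have sf : sigma_finite setT mu.
  exists (fun k => cube k.+1%:R).
    apply/seteqP; split => // v _.
    have [k _ vk] : (\bigcup_k @cube d k%:R) v by rewrite bigcup_cube.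
    by exists k => // i; rewrite (le_trans (vk i))// ler_nat.
  by move=> k; split; [exact: measurable_cube|rewrite mur// ltry].
exists (image_measure ((@lebesgue_measure R) \x (sigma_finite_copy sf))%E (@measurable_cons_cV d)).
  by apply/funext => A; rewrite /= /pushforward -muE.
move=> r r0; rewrite /image_measure /= /pushforward /= cons_cube ?ltW//.
rewrite product_measure1E//; last exact: measurable_cube.
rewrite /= mur// lebesgue_measure_itv/= lte_fin gtrN// -EFinD -EFinM.
by rewrite opprK exprS mulr2n.
Qed.

Lemma lebesgue_cV0 d : @lebesgue_cV R d set0 = 0%E.
Proof. by have [mu <- _] := lebesgue_cV_measure_cube d. Qed.

Lemma lebesgue_cV_ge0 d A : (0 <= @lebesgue_cV R d A)%E.
Proof. by have [mu <- _] := lebesgue_cV_measure_cube d. Qed.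

Lemma lebesgue_cV_semi_sigma_additive d :
  semi_sigma_additive (@lebesgue_cV R d).
Proof.
by have [mu <- _] := lebesgue_cV_measure_cube d; exact: measure_semi_sigma_additive.
Qed.

HB.instance Definition _ d := isMeasure.Build _ _ _ (@lebesgue_cV R d)
  (lebesgue_cV0 d) (@lebesgue_cV_ge0 d) (@lebesgue_cV_semi_sigma_additive d).

Lemma lebesgue_cV_cube d r : 0 < r ->
  @lebesgue_cV R d (cube r) = ((r *+ 2) ^+ d)%:E.
Proof. by have [mu <-] := lebesgue_cV_measure_cube d; exact. Qed.

Lemma sigma_finite_cube d (mu : {measure set 'cV[R]_d -> \bar R}) :
  (forall r, (mu (cube r) < +oo)%E) -> sigma_finite setT mu.
Proof.
move=> mur; exists (fun k => cube k%:R); first by rewrite bigcup_cube.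
by move=> k; split; [exact: measurable_cube|exact: mur].
Qed.

Lemma lebesgue_cV_cube_lty d r : (@lebesgue_cV R d (cube r) < +oo)%E.
Proof.
apply: (@le_lt_trans _ _ (@lebesgue_cV R d (cube (Num.max 1 r)))).
  apply: le_measure; rewrite ?inE; [exact: measurable_cube..|].
  by move=> v vr i; rewrite le_max vr orbT.
by rewrite lebesgue_cV_cube ?ltry// lt_max ltr01.
Qed.

HB.instance Definition _ d := Measure_isSigmaFinite.Build _ _ _
  (@lebesgue_cV R d) (sigma_finite_cube (@lebesgue_cV_cube_lty d)).

Lemma lebesgue_cVSE d : @lebesgue_cV R d.+1 =
  pushforward ((@lebesgue_measure R) \x @lebesgue_cV R d)%E (@cons_cV d).
Proof. by []. Qed.

Lemma ge0_integral_lebesgue_cVS d (f : 'cV[R]_d.+1 -> \bar R) :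
  measurable_fun setT f -> (forall v, (0 <= f v)%E) ->
  (\int[@lebesgue_cV R d.+1]_v f v =
   \int[@lebesgue_measure R]_x \int[@lebesgue_cV R d]_w f (cons_cV (x, w)))%E.
Proof.
move=> mf f0; rewrite lebesgue_cVSE ge0_integral_pushforward//; last first.
  exact: measurable_cons_cV.
rewrite preimage_setT fubini_tonelli1//.
  exact: (measurableT_comp mf (@measurable_cons_cV d)).
by move=> p; exact: f0.
Qed.

Lemma lebesgue_measure_shift (t : R) (A : set R) : measurable A ->
  lebesgue_measure [set x | A (x + t)] = lebesgue_measure A.
Proof.
move=> mA.
suff : pushforward (@lebesgue_measure R) ((fun x : R => x + t) : _ -> measurableTypeR R) A
    = lebesgue_measure A by [].
apply/esym/lebesgue_measure_unique => //=; first exact: measurable_funD.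
move=> mt _ [[a b]] _ <-; rewrite /pushforward/= (_ : _ @^-1` _ = `]a - t, b - t]%classic).
  by rewrite !lebesgue_measure_itv/= !lte_fin ltrBlDr subrK -!EFinB opprB addrA subrK.
by apply/seteqP; split => x /=; rewrite !in_itv/= ltrBlDr lerBrDr.
Qed.

Lemma lebesgue_cV_shift d (t : 'cV[R]_d) (A : set 'cV[R]_d) : measurable A ->
  lebesgue_cV [set v | A (v + t)] = lebesgue_cV A.
Proof.
elim: d t A => [|d IH] t A mA.
  by congr (lebesgue_cV _); apply/seteqP; split => v /=; rewrite (flatmx0 t) addr0.
have [[t1 t2] ->] := cons_cV_surj t.
have mS B : measurable B -> measurable [set p | B (@cons_cV d p)].
  by move=> mB; rewrite -[X in measurable X]setTI; exact: measurable_cons_cV.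
rewrite !lebesgue_cVSE /pushforward /product_measure1.
pose phi x := lebesgue_cV [set w | A (@cons_cV d (x, w))].
have mphi : measurable_fun setT phi.
  have := measurable_fun_xsection (@lebesgue_cV R d) (mS A mA).
  by congr (measurable_fun _ _); apply/funext => x; rewrite /= xsectionE.
transitivity (\int[@lebesgue_measure R]_x phi (x + t1)%R)%E.
  apply: eq_integral => x _; rewrite /= xsectionE /= /phi.
  rewrite -(IH t2 [set w | A (cons_cV (x + t1, w))]).
    by congr (lebesgue_cV _); apply/seteqP; split=> w /=; rewrite cons_cVD.
  by have := measurable_xsection (x + t1) (mS A mA); rewrite xsectionE.
have mt : measurable_fun setT (fun x : R => x + t1) by exact: measurable_funD.
transitivity (\int[pushforward (@lebesgue_measure R)
    ((fun x : R => x + t1)%R : _ -> measurableTypeR R)]_x phi x)%E.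
  by rewrite ge0_integral_pushforward// => x _; exact: lebesgue_cV_ge0.
transitivity (\int[@lebesgue_measure R]_x phi x)%E.
  apply: eq_measure_integral => //= B mB _.
  exact: lebesgue_measure_shift.
by apply: eq_integral => x _; rewrite /= xsectionE.
Qed.

Lemma integral_xsection_ysection d1 d2 (T1 : measurableType d1)
    (T2 : measurableType d2) (m1 : {sigma_finite_measure set T1 -> \bar R})
    (m2 : {sigma_finite_measure set T2 -> \bar R}) (A : set (T1 * T2)) :
  measurable A ->
  (\int[m1]_x m2 [set y | A (x, y)] = \int[m2]_y m1 [set x | A (x, y)])%E.
Proof.
move=> mA; have := indic_fubini_tonelli m1 m2 mA.
rewrite indic_fubini_tonelli_FE// indic_fubini_tonelli_GE//.
under eq_integral do rewrite /= xsectionE.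
by under [in RHS]eq_integral do rewrite /= ysectionE.
Qed.

(* Both sides are the integral of 1_A(x) 1_B(x + y) against nu(dx) dy. *)
Lemma translation_invariant_measure d (nu : {sigma_finite_measure set 'cV[R]_d -> \bar R})
    (A B : set 'cV[R]_d) :
  (forall (t : 'cV[R]_d) (C : set 'cV[R]_d), measurable C -> nu [set v | C (v + t)] = nu C) ->
  measurable A -> measurable B ->
  (nu A * lebesgue_cV B = nu B * lebesgue_cV [set v | A (- v)%R])%E.
Proof.
move=> nut mA mB.
have mN : measurable [set v | A (- v)].
  rewrite -[X in measurable X]setTI; apply: (measurable_mxN (@measurable_id _ _ setT)) => //.
have m2 (f : 'cV[R]_d * 'cV[R]_d -> 'cV[R]_d) C : measurable C -> measurable_fun setT f ->
    measurable [set p | C (f p)].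
  by move=> mC mf; rewrite -[X in measurable X]setTI; exact: mf.
have mD : measurable_fun setT (fun p : 'cV[R]_d * 'cV[R]_d => p.1 + p.2).
  by apply: measurable_mxD; [exact: measurable_fst|exact: measurable_snd].
have mBr : measurable_fun setT (fun p : 'cV[R]_d * 'cV[R]_d => p.1 - p.2).
  by apply: measurable_mxB; [exact: measurable_fst|exact: measurable_snd].
have mf1 : measurable_fun setT (fun p : 'cV[R]_d * 'cV[R]_d => p.1) by exact: measurable_fst.
pose S := [set p : 'cV[R]_d * 'cV[R]_d | A p.1 /\ B (p.1 + p.2)].
pose S' := [set p : 'cV[R]_d * 'cV[R]_d | A (p.1 - p.2) /\ B p.1].
have mS : measurable S by apply: measurableI; apply: m2.
have mS' : measurable S' by apply: measurableI; apply: m2.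
have cst_int C D : measurable C -> (0 <= D)%E ->
    (\int[nu]_x ((\1_C x)%:E * D) = nu C * D)%E.
  move=> mC D0; rewrite ge0_integralZr ?integral_indic ?setIT//.
  exact/measurable_EFinP/measurable_indic.
have HL : (\int[nu]_x lebesgue_cV [set y | S (x, y)] = nu A * lebesgue_cV B)%E.
  rewrite -(cst_int A (lebesgue_cV B))//.
  apply: eq_integral => x _; rewrite indicE /S /=; have [/set_mem Ax|/negP nA] /= := boolP (x \in A).
  - rewrite mul1e -(lebesgue_cV_shift x mB); congr (lebesgue_cV _).
    by apply/seteqP; split=> y /= => [[_]|]; rewrite addrC.
  - rewrite mul0e (_ : [set y | _] = set0) ?lebesgue_cV0//.
    by apply/seteqP; split=> // y /= [Ax _]; apply: nA; rewrite inE.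
have HR : (\int[nu]_x lebesgue_cV [set y | S' (x, y)] = nu B * lebesgue_cV [set v | A (- v)%R])%E.
  rewrite -(cst_int B (lebesgue_cV [set v | A (- v)]))//.
  apply: eq_integral => x _; rewrite indicE /S' /=; have [/set_mem Bx|/negP nB] /= := boolP (x \in B).
  - rewrite mul1e -(lebesgue_cV_shift (- x) mN); congr (lebesgue_cV _).
    by apply/seteqP; split=> y /= => [[]|]; rewrite opprB.
  - rewrite mul0e (_ : [set y | _] = set0) ?lebesgue_cV0//.
    by apply/seteqP; split=> // y /= [_ Bx]; apply: nB; rewrite inE.
rewrite -HL -HR !(@integral_xsection_ysection _ _ _ _ nu (@lebesgue_cV R d))//.
apply: eq_integral => y _; rewrite -(nut y [set x | S' (x, y)]).
  by congr (nu _); apply/seteqP; split=> x /=; rewrite /S /S' /= addrK.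
have := measurable_ysection y mS'; by rewrite ysectionE.
Qed.

Definition euclidean_ball d : set 'cV[R]_d := [set v | sqnorm v <= 1].
Arguments euclidean_ball : clear implicits.

Lemma measurable_euclidean_ball d : measurable (euclidean_ball d).
Proof.
have -> : euclidean_ball d = setT `&` (@sqnorm R d) @^-1` `]-oo, 1].
  by apply/seteqP; split=> v /= => [v1|[_]]; rewrite in_itv.
apply: (measurable_sqnorm (@measurable_id _ _ setT)) => //.
Qed.

Lemma cube_sqnorm d (r : R) (v : 'cV[R]_d) : 0 <= r -> sqnorm v <= r ^+ 2 -> cube r v.
Proof.
move=> r0 vr i; apply: le_trans (normr_le_enorm v i) _.
by rewrite -(ler_pXn2r (n := 2)) ?nnegrE ?sqrtr_ge0// sqr_sqrtr ?sqnorm_ge0.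
Qed.

Lemma euclidean_ball_sub_cube d : euclidean_ball d `<=` cube 1.
Proof. by move=> v /= v1; apply: cube_sqnorm => //; rewrite expr1n. Qed.

Lemma lebesgue_ball_lty d : (lebesgue_cV (euclidean_ball d) < +oo)%E.
Proof.
apply: le_lt_trans (lebesgue_cV_cube_lty d 1).
apply: le_measure; rewrite ?inE; [exact: measurable_euclidean_ball|exact: measurable_cube|].
exact: euclidean_ball_sub_cube.
Qed.

(** Any radius up to the inverse root of [d] would fit; this one needs no root and stays positive in
    dimension 0. *)
Lemma cube_sub_euclidean_ball d : @cube d (d.+1%:R^-1) `<=` euclidean_ball d.
Proof.
move=> v vd; rewrite /euclidean_ball /= sqnormE.
apply: (@le_trans _ _ (\sum_(i < d) d.+1%:R^-1)).
  apply: ler_sum => i _; rewrite -real_normK ?num_real//.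
  apply: (@le_trans _ _ (d.+1%:R^-1 ^+ 2)); first by rewrite lerXn2r ?nnegrE// vd.
  by rewrite expr2 ler_piMr// invf_le1// ler1n.
rewrite sumr_const card_ord -[_ *+ _]mulr_natl ler_pdivrMr// mul1r ler_nat.
exact: leqnSn.
Qed.

Lemma lebesgue_ball_gt0 d : (0 < lebesgue_cV (euclidean_ball d))%E.
Proof.
apply: (@lt_le_trans _ _ (lebesgue_cV (@cube d (d.+1%:R^-1)))).
  by rewrite lebesgue_cV_cube// lte_fin exprn_gt0// mulrn_wgt0.
apply: le_measure; rewrite ?inE; [exact: measurable_cube|exact: measurable_euclidean_ball|].
exact: cube_sub_euclidean_ball.
Qed.

(** Lebesgue measure itself is put for [nu] in the identity for translation-invariant measures; the
    ball, of positive finite measure, then cancels. *)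
Lemma lebesgue_cVN d (A : set 'cV[R]_d) : measurable A ->
  lebesgue_cV [set v | A (- v)] = lebesgue_cV A.
Proof.
move=> mA; have := translation_invariant_measure (@lebesgue_cV_shift d) mA
  (@measurable_euclidean_ball d).
rewrite muleC /= => H; have B0 := lebesgue_ball_gt0 d.
have fB : lebesgue_cV (euclidean_ball d) \is a fin_num.
  by rewrite ge0_fin_numE ?lebesgue_ball_lty// ltW.
by apply/eqP; rewrite eq_le -(lee_pmul2l fB B0) -[X in _ && X](lee_pmul2l fB B0) H lexx.
Qed.

(** Uniqueness of Haar measure, with the factor read off at the unit ball and the division
    cleared. *)
Lemma translation_invariant_lebesgue d
    (nu : {sigma_finite_measure set 'cV[R]_d -> \bar R}) (A : set 'cV[R]_d) :
  (forall (t : 'cV[R]_d) (C : set 'cV[R]_d), measurable C -> nu [set v | C (v + t)] = nu C) ->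
  measurable A ->
  (nu A * lebesgue_cV (euclidean_ball d) = nu (euclidean_ball d) * lebesgue_cV A)%E.
Proof.
move=> nut mA.
by rewrite translation_invariant_measure ?lebesgue_cVN//; exact: measurable_euclidean_ball.
Qed.

Lemma integral_gauss1 :
  (\int[@lebesgue_measure R]_x (expR (- (x ^+ 2 / 2)))%:E = (Num.sqrt (2 * pi))%:E)%E.
Proof.
have := @integral_normal_pdf R 0 1.
under eq_integral do rewrite normal_pdfE ?oner_neq0// EFinM.
rewrite ge0_integralZl//=; last 3 first.
- by apply/measurable_EFinP; exact: measurable_normal_fun.
- by move=> x _; rewrite lee_fin normal_fun_ge0.
- by rewrite lee_fin normal_peak_ge0.
have -> : (normal_peak 1 : R) = (Num.sqrt (2 * pi))^-1.
  by rewrite /normal_peak expr1n mul1r mulr_natl.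
under eq_integral do rewrite /normal_fun subr0 expr1n mulNr.
move=> H; have s0 : Num.sqrt (2 * pi) != 0 :> R.
  by rewrite gt_eqF// sqrtr_gt0 mulr_gt0// pi_gt0.
rewrite -[LHS]mul1e -[X in (X * _)%E](_ : (Num.sqrt (2 * pi))%:E * ((Num.sqrt (2 * pi))^-1)%:E = _)%E.
  by rewrite -muleA H mule1.
by rewrite -EFinM mulfV.
Qed.

Lemma integral_gauss d :
  (\int[@lebesgue_cV R d]_v (expR (- (sqnorm v / 2)))%:E =
   (Num.sqrt (2 * pi) ^+ d)%:E)%E.
Proof.
have mg k : measurable_fun setT (fun v : 'cV[R]_k => (expR (- (sqnorm v / 2)))%:E).
  apply/measurable_EFinP; apply: measurableT_comp => //; apply: measurableT_comp => //.
  apply: measurable_funM => //; exact: (measurable_sqnorm (@measurable_id _ _ setT)).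
elim: d => [|d IH].
  transitivity (\int[\d_(0%R : 'cV[R]_0)]_v (expR (- (sqnorm v / 2)))%:E)%E => //.
  by rewrite integral_dirac// sqnormE big_ord0 mul0r oppr0 expR0 expr0 diracT mul1e.
rewrite ge0_integral_lebesgue_cVS//.
transitivity (\int[@lebesgue_measure R]_x ((expR (- (x ^+ 2 / 2)))%:E * (Num.sqrt (2 * pi) ^+ d)%:E))%E.
  apply: eq_integral => x _; rewrite -IH -ge0_integralZl//=.
  apply: eq_integral => v _; rewrite sqnorm_cons/= -EFinM -expRD.
  by congr (expR _)%:E; field.
  exact: mg.
rewrite ge0_integralZr//.
- by rewrite integral_gauss1 -EFinM exprS.
- apply/measurable_EFinP; apply: measurableT_comp => //; apply: measurableT_comp => //.
  by apply: measurable_funM => //; exact: measurable_funX.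
Qed.

End LebesgueMeasure.

(** * Orthonormal frames, projectors, and Lebesgue measure on subspaces *)

Section OrthonormalFrame.
Variable R : realType.

Lemma sqnorm_eq0 n (v : 'cV[R]_n) : sqnorm v = 0 -> v = 0.
Proof.
rewrite sqnormE => /psumr_eq0P v0; apply/matrixP => i j; rewrite ord1 mxE.
by apply/eqP; rewrite -sqrf_eq0 v0// => k _; exact: sqr_ge0.
Qed.

Lemma sqnormZ n (a : R) (v : 'cV[R]_n) : sqnorm (a *: v) = a ^+ 2 * sqnorm v.
Proof. by rewrite !sqnormE mulr_sumr; apply: eq_bigr => i _; rewrite mxE exprMn. Qed.

Lemma sqnorm_isometry n d (Q : 'M[R]_(n, d)) (w : 'cV[R]_d) :
  Q^T *m Q = 1%:M -> sqnorm (Q *m w) = sqnorm w.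
Proof. by move=> QQ; rewrite /sqnorm trmx_mul mulmxA -(mulmxA w^T) QQ mulmx1. Qed.

Lemma exists_kernel_vector p n (A : 'M[R]_(p, n)) : (p < n)%N ->
  exists2 v : 'cV[R]_n, v != 0 & A *m v = 0.
Proof.
move=> pn; pose K := kermx A^T.
have K0 : K != 0.
  rewrite -mxrank_eq0 mxrank_ker subn_eq0 -ltnNge.
  by rewrite mxrank_tr (leq_ltn_trans (rank_leq_row A)).
exists (nz_row K)^T; first by rewrite trmx_eq0 nz_row_eq0.
apply: trmx_inj; rewrite trmx_mul trmxK trmx0.
apply: sub_kermxP; exact: nz_row_sub.
Qed.

(** Each new column is a unit vector killed by [C] and by [Q^T]; these stacked have [m + k < n]
    rows, hence a nontrivial kernel. *)
Lemma exists_orthonormal_kernel m n (C : 'M[R]_(m, n)) k : (m + k <= n)%N ->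
  exists Q : 'M[R]_(n, k), C *m Q = 0 /\ Q^T *m Q = 1%:M.
Proof.
elim: k => [|k IH] mkn.
  by exists 0; split; [rewrite mulmx0|apply/matrixP => -[]].
have [|Q [CQ QQ]] := IH; first by rewrite (leq_trans _ mkn)// leq_add2l.
have [|v v0 Av] := @exists_kernel_vector _ _ (col_mx C Q^T); first by rewrite -addnS.
move: Av; rewrite mul_col_mx -[0]vsubmxK => /eq_col_mx[]; rewrite !linear0 => Cv Qv.
have s0 : 0 < sqnorm v.
  by rewrite lt_def sqnorm_ge0 andbT; apply: contra v0 => /eqP/sqnorm_eq0->.
pose w := (enorm v)^-1 *: v.
have ww : w^T *m w = 1%:M.
  apply/matrixP => i j; rewrite !ord1 -/(sqnorm w) sqnormZ mxE eqxx exprVn.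
  by rewrite sqr_sqrtr ?ltW// mulVf// gt_eqF.
have Qw : Q^T *m w = 0 by rewrite -scalemxAr Qv scaler0.
suff : exists Q' : 'M[R]_(n, k + 1), C *m Q' = 0 /\ Q'^T *m Q' = 1%:M by rewrite addn1.
exists (row_mx Q w); split; first by rewrite mul_mx_row CQ -scalemxAr Cv scaler0 row_mx0.
rewrite tr_row_mx mul_col_row QQ Qw ww -[w^T *m Q]trmxK trmx_mul trmxK Qw trmx0.
by rewrite -scalar_mx_block.
Qed.

(** For [C] of full row rank, the orthogonal projector onto its kernel. The inverse of the Gram
    matrix is spelled out by Cramer's rule, which makes the entries visibly measurable in [C]. *)
Definition kernel_projector m n (C : 'M[R]_(m, n)) : 'M[R]_n :=
  1%:M - C^T *m ((\det (C *m C^T))^-1 *: \adj (C *m C^T)) *m C.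

Lemma unitmx_gram m n (C : 'M[R]_(m, n)) : row_free C -> C *m C^T \in unitmx.
Proof.
move=> freeC; rewrite unitmxE unitfE; apply/det0P => -[v v0 vCC].
have : v *m C = 0.
  apply: trmx_inj; rewrite trmx0; apply: sqnorm_eq0.
  by rewrite /sqnorm trmxK trmx_mul mulmxA -(mulmxA v) vCC mul0mx mxE.
by move/eqP; rewrite mulmx_free_eq0//; exact/negP.
Qed.

(** Both [C] and [Q^T] kill the difference [D] of the two sides from the left. Stacked, they have
    [m + (n - m) = n] independent rows, hence a left inverse, so [D] vanishes. *)
Lemma kernel_projectorE m n (C : 'M[R]_(m, n)) (Q : 'M[R]_(n, n - m)) :
  \rank C = m -> C *m Q = 0 -> Q^T *m Q = 1%:M -> kernel_projector C = Q *m Q^T.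
Proof.
move=> rC CQ QQ; have freeC : row_free C by rewrite /row_free rC.
have uG := unitmx_gram freeC.
have mn : (m <= n)%N by rewrite -{1}rC rank_leq_col.
pose P := C^T *m invmx (C *m C^T) *m C.
have -> : kernel_projector C = 1%:M - P.
  by rewrite /kernel_projector /P /invmx uG.
suff D0 : 1%:M - P - Q *m Q^T = 0 by apply/subr0_eq.
pose M := col_mx C Q^T.
have QC : Q^T *m C^T = 0 by rewrite -trmx_mul CQ trmx0.
have fullM : row_full M.
  suff freeM : row_free M by rewrite /row_full (eqP freeM) subnKC.
  apply: inj_row_free => v; rewrite -[v]hsubmxK mul_row_col => vM.
  have b0 : rsubmx v = 0.
    have : (lsubmx v *m C + rsubmx v *m Q^T) *m Q = 0 by rewrite vM mul0mx.
    by rewrite mulmxDl -!mulmxA CQ QQ mulmx0 mulmx1 add0r.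
  move: vM; rewrite b0 mul0mx addr0 => /eqP.
  by rewrite mulmx_free_eq0// => /eqP->; rewrite row_mx0.
have [B BM] := row_fullP fullM.
set D := LHS; rewrite -[D]mul1mx -BM -mulmxA mul_col_mx.
have -> : C *m D = 0.
  rewrite /D.
  rewrite !mulmxBr mulmx1 (mulmxA C Q) CQ mul0mx subr0 /P !mulmxA.
  by rewrite mulmxV// mul1mx subrr.
have -> : Q^T *m D = 0.
  rewrite /D.
  rewrite !mulmxBr mulmx1 (mulmxA Q^T Q) QQ mul1mx /P !mulmxA QC !mul0mx subr0.
  by rewrite subrr.
by rewrite col_mx0 mulmx0.
Qed.

Lemma sqnorm_pythagoras n d (Q : 'M[R]_(n, d)) (u : 'cV[R]_n) :
  Q^T *m Q = 1%:M ->
  sqnorm u = sqnorm (Q^T *m u) + sqnorm (u - Q *m Q^T *m u).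
Proof.
move=> QQ; have -> : sqnorm (Q^T *m u) = sqnorm (Q *m Q^T *m u).
  by rewrite -mulmxA (sqnorm_isometry _ QQ).
set p := Q *m Q^T *m u; have pu : p^T *m (u - p) = 0.
  rewrite mulmxBr /p !trmx_mul trmxK !mulmxA -[_ *m Q^T *m Q]mulmxA QQ mulmx1.
  by rewrite subrr.
have uE : u = p + (u - p) by rewrite addrC subrK.
rewrite {1}uE; move: (u - p) pu => e pe.
have ep : e^T *m p = 0 by rewrite -[LHS]trmxK trmx_mul trmxK pe trmx0.
by rewrite /sqnorm [(p + e)^T]raddfD/= mulmxDl !mulmxDr pe ep addr0 add0r mxE.
Qed.

(** For an orthogonal projector, the points within distance 1 of its range: a thickening, because
    the range itself may be a null set for [n]-dimensional Lebesgue measure. *)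
Definition frame_slab n (P : 'M[R]_n) : set 'cV[R]_n := [set u | sqnorm (u - P *m u) <= 1].

Lemma measurable_sqnorm_le d (T : measurableType d) n (f : T -> 'cV[R]_n) (r : R) :
  measurable_fun setT f -> measurable [set t | sqnorm (f t) <= r].
Proof.
move=> mf; have -> : [set t | sqnorm (f t) <= r] = setT `&` (fun t => sqnorm (f t)) @^-1` `]-oo, r].
  by apply/seteqP; split=> v /= => [v1|[_]]; rewrite in_itv.
by apply: (measurable_sqnorm mf) => //.
Qed.

Lemma measurable_mulmxl m n p (A : 'M[R]_(m, n)) :
  measurable_fun setT (fun u : 'M[R]_(n, p) => A *m u).
Proof. by apply: measurable_mulmx; [exact: measurable_cst|exact: measurable_id]. Qed.

Lemma measurable_frame_slab n (P : 'M[R]_n) : measurable (frame_slab P).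
Proof.
apply: measurable_sqnorm_le; apply: measurable_mxB; first exact: measurable_id.
exact: measurable_mulmxl.
Qed.

(* The right-hand side involves Q only through the projector Q Q^T, which is a
   rational function of the constraint Jacobian: this is what makes
   tangent_lebesgue measurable in x although tangent_frame is an arbitrary choice. *)
Lemma lebesgue_frame n d (Q : 'M[R]_(n, d)) (A : set 'cV[R]_n) (P := Q *m Q^T) :
  Q^T *m Q = 1%:M -> measurable A ->
  lebesgue_cV [set w | A (Q *m w)] =
    (((fine (lebesgue_cV [set u | sqnorm (P *m u) <= 1 /\ frame_slab P u]))^-1)%:E *
     (lebesgue_cV (@euclidean_ball R d) * lebesgue_cV [set u | A (P *m u) /\ frame_slab P u]))%E.
Proof.
move=> QQ mA; have mS := measurable_frame_slab P.
have mB k (f : 'cV[R]_k -> 'cV[R]_n) : measurable_fun setT f -> measurable [set w | A (f w)].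
  by move=> mf; rewrite -[X in measurable X]setTI; exact: mf.
(* Lebesgue measure on the slab, projected to coordinates by [Q^T]. Translations along the range of
   [Q] preserve the slab, so [nu] is translation-invariant and a multiple of Lebesgue measure. *)
pose nu := image_measure (mrestr (@lebesgue_cV R n) mS) (@measurable_mulmxl d n 1 Q^T).
have nuE B : nu B = lebesgue_cV [set u | B (Q^T *m u) /\ frame_slab P u] by [].
have nusf : sigma_finite setT nu.
  apply: sigma_finite_cube => r; rewrite nuE.
  (* On the set in question [sqnorm u] is at most [d%:R * r ^+ 2 + 1]; the maximum with 1 gives
     [s <= s ^+ 2], so [cube s] contains it. *)
  pose s := Num.max 1 (d%:R * r ^+ 2 + 1).
  apply: le_lt_trans (lebesgue_cV_cube_lty n s).
  apply: le_measure; rewrite ?inE; [|exact: measurable_cube|].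
    apply: measurableI => //; rewrite -[X in measurable X]setTI.
    by apply: measurable_mulmxl => //; exact: measurable_cube.
  move=> u [ur us]; have s1 : 1 <= s by rewrite le_max lexx.
  apply: cube_sqnorm; first by rewrite (le_trans ler01).
  rewrite (sqnorm_pythagoras _ QQ); apply: (@le_trans _ _ s).
    rewrite le_max; apply/orP; right; apply: lerD => //.
    rewrite sqnormE -[d in d%:R]card_ord mulr_natl -sumr_const; apply: ler_sum => j _.
    by rewrite -real_normK ?num_real// lerXn2r ?nnegrE ?(le_trans _ (ur j)).
  by rewrite expr2 ler_peMl// (le_trans ler01).
have nut (t : 'cV[R]_d) (B : set 'cV[R]_d) : measurable B -> nu [set v | B (v + t)] = nu B.
  move=> mB'; rewrite !nuE -[RHS](lebesgue_cV_shift (Q *m t)); last first.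
    apply: measurableI => //; rewrite -[X in measurable X]setTI.
    exact: measurable_mulmxl.
  congr (lebesgue_cV _); apply/seteqP; split => u /=;
   rewrite /frame_slab/= !mulmxDr /P -(mulmxA Q _ (Q *m t)) (mulmxA Q^T Q t) QQ mul1mx;
   by rewrite opprD addrACA subrr addr0.
have := @translation_invariant_lebesgue _ _ (sigma_finite_copy nusf) [set w | A (Q *m w)] nut
  (mB _ _ (measurable_mulmxl _)).
rewrite /sigma_finite_copy !nuE.
have -> : [set u | [set w | A (Q *m w)] (Q^T *m u) /\ frame_slab P u] =
    [set u | A (P *m u) /\ frame_slab P u].
  by apply/seteqP; split => u /=; rewrite /P mulmxA.
have -> : [set u | @euclidean_ball R d (Q^T *m u) /\ frame_slab P u] =
    [set u | sqnorm (P *m u) <= 1 /\ frame_slab P u].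
  by apply/seteqP; split => u /=; rewrite /euclidean_ball/= /P -mulmxA (sqnorm_isometry _ QQ).
(* This set contains the unit ball and lies in [cube 2], so [D] is positive and finite and the
   inverse of [fine D] is a genuine one. *)
set D := lebesgue_cV [set u | sqnorm _ <= 1 /\ _]; move=> H.
have mD : measurable [set u | sqnorm (P *m u) <= 1 /\ frame_slab P u].
  by apply: measurableI => //; apply: measurable_sqnorm_le; exact: measurable_mulmxl.
have D_lty : (D < +oo)%E.
  apply: le_lt_trans (lebesgue_cV_cube_lty n 2).
  apply: le_measure; rewrite ?inE; [exact: mD|exact: measurable_cube|].
  move=> u [u1 u2]; apply: cube_sqnorm => //; rewrite (sqnorm_pythagoras _ QQ).
  have : sqnorm (Q^T *m u) <= 1 by move: u1; rewrite /P -mulmxA (sqnorm_isometry _ QQ).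
  by move: u2; rewrite /frame_slab /= -/P; lra.
have D_gt0 : (0 < D)%E.
  apply: lt_le_trans (lebesgue_ball_gt0 R n) _.
  apply: le_measure; rewrite ?inE; [exact: measurable_euclidean_ball|exact: mD|].
  move=> u /=; rewrite /euclidean_ball/= (sqnorm_pythagoras _ QQ) => h; split.
    rewrite /P -mulmxA (sqnorm_isometry _ QQ) (le_trans _ h)// lerDl sqnorm_ge0//.
  by rewrite /frame_slab/= (le_trans _ h)// lerDr sqnorm_ge0.
have fD : D \is a fin_num by rewrite ge0_fin_numE// ltW.
rewrite muleC in H; rewrite H -{2}(fineK fD) muleA -EFinM mulVf ?mul1e//.
by rewrite gt_eqF// fine_gt0// D_gt0.
Qed.

End OrthonormalFrame.

(** * Mixtures of measures and integration against them *)

Section Mixture.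
Variables (R : realType) (d1 d2 : measure_display).
Variables (X : measurableType d1) (Y : measurableType d2).
Variables (mu : {measure set X -> \bar R}) (D : set X).
Variable k : X -> {measure set Y -> \bar R}.

(** The measurability proofs are arguments because the measure structure attached below depends on
    them. The mixing measure [mu] is arbitrary, so that a Hausdorff measure may be used. *)
Definition mixture (mD : measurable D)
    (mk : forall A, measurable A -> measurable_fun D (fun x => k x A)) (A : set Y) : \bar R :=
  (\int[mu]_(x in D) k x A)%E.

Hypothesis mD : measurable D.
Hypothesis mk : forall A, measurable A -> measurable_fun D (fun x => k x A).

Let mixture0 : mixture mD mk set0 = 0%E.
Proof. by rewrite /mixture integral0_eq// => x _; rewrite measure0. Qed.

Let mixture_ge0 A : (0 <= mixture mD mk A)%E.
Proof. exact: integral_ge0. Qed.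

Let mixture_semi_sigma_additive : semi_sigma_additive (mixture mD mk).
Proof.
move=> F mF tF mUF.
rewrite [X in _ --> X](_ : _ = \sum_(0 <= n <oo) mixture mD mk (F n))%E.
  by apply/cvg_closeP; split; [exact: is_cvg_nneseries|rewrite closeE].
rewrite /mixture -integral_nneseries//; last by move=> n; exact: mk.
apply: eq_integral => x _; apply/esym/cvg_lim => //=.
exact: measure_sigma_additive.
Qed.

HB.instance Definition _ := isMeasure.Build _ _ _ (mixture mD mk)
  mixture0 mixture_ge0 mixture_semi_sigma_additive.

Import HBNNSimple.

Let integral_simple (nu : {measure set Y -> \bar R}) (g : {nnsfun Y >-> R}) :
  (\int[nu]_y (g y)%:E = \sum_(r \in range g) r%:E * nu (g @^-1` [set r]))%E.
Proof. by rewrite integralT_nnsfun sintegralE. Qed.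

Let measurable_simple (g : {nnsfun Y >-> R}) :
  measurable_fun D (fun x => \int[k x]_y (g y)%:E)%E.
Proof.
under eq_fun do rewrite integral_simple.
by apply: emeasurable_fsum => // r; apply: measurable_funeM; exact: mk.
Qed.

Let mixture_simple (g : {nnsfun Y >-> R}) :
  (\int[mixture mD mk]_y (g y)%:E = \int[mu]_(x in D) \int[k x]_y (g y)%:E)%E.
Proof.
rewrite integral_simple; under [RHS]eq_integral do rewrite integral_simple.
rewrite ge0_integral_fsum//; last 2 first.
- by move=> r; apply: measurable_funeM; exact: mk.
- by move=> r x _; exact: nnsfun_mulemu_ge0.
apply: eq_fsbigr => r /set_mem[y _ <-].
transitivity ((g y)%:E * \int[mu]_(x in D) k x (g @^-1` [set g y]))%E => //.
rewrite ge0_integralZl//; first [exact: mk|by rewrite lee_fin].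
Qed.

Variable f : Y -> \bar R.
Hypothesis mf : measurable_fun setT f.
Hypothesis f0 : forall y, (0 <= f y)%E.

Let g := nnsfun_approx measurableT mf.

Let cvg_g (nu : {measure set Y -> \bar R}) :
  (\int[nu]_y (g n y)%:E @[n --> \oo] --> \int[nu]_y f y)%E.
Proof.
rewrite [X in _ --> X](_ : _ = \int[nu]_y (limn (EFin \o g ^~ y)))%E; last first.
  by apply: eq_integral => y _; apply/esym/cvg_lim => //; exact: cvg_nnsfun_approx.
apply: cvg_monotone_convergence => //.
- by move=> n; exact/measurable_EFinP.
- by move=> n y _; rewrite lee_fin.
- by move=> y _ a b ab; rewrite lee_fin; exact/lefP/nd_nnsfun_approx.
Qed.

Lemma measurable_fun_integral_mixture : measurable_fun D (fun x => \int[k x]_y f y)%E.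
Proof.
apply: (emeasurable_fun_cvg (fun n x => \int[k x]_y (g n y)%:E)%E) => //.
Qed.

Lemma integral_mixture :
  (\int[mixture mD mk]_y f y = \int[mu]_(x in D) \int[k x]_y f y)%E.
Proof.
transitivity (limn (fun n => \int[mu]_(x in D) \int[k x]_y (g n y)%:E))%E.
  apply/esym/cvg_lim => //.
  by under eq_fun do rewrite -mixture_simple; exact: cvg_g.
rewrite -monotone_convergence//.
- by apply: eq_integral => x _; apply/cvg_lim => //; exact: cvg_g.
- by move=> n x _; apply: integral_ge0 => y _; rewrite lee_fin.
- move=> x _ a b ab; apply: ge0_le_integral => //.
  + by move=> y _; rewrite lee_fin.
  + exact/measurable_EFinP.
  + exact/measurable_EFinP.
  + by move=> y _; rewrite lee_fin; exact/lefP/nd_nnsfun_approx.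
Qed.

End Mixture.

(** * Measures given by a density *)

Section Density.
Variables (R : realType) (d : measure_display) (X : measurableType d).
Variables (mu : {measure set X -> \bar R}) (D : set X) (w : X -> R).
Hypothesis mD : measurable D.
Hypothesis mw : measurable_fun D w.
Hypothesis w0 : forall x, 0 <= w x.

Let k x := mscale (NngNum (w0 x)) (\d_x : {measure set X -> \bar R}).

Let mk A : measurable A -> measurable_fun D (fun x => k x A).
Proof.
move=> mA; rewrite /k /mscale/=; apply: emeasurable_funM; first exact/measurable_EFinP.
by apply/measurable_EFinP; apply: measurable_funTS; exact: measurable_indic.
Qed.

(** A mixture of Dirac masses scaled by [w], so that additivity and the integration formula are
    inherited from [mixture]. The integral over [A] intersected with [D] is the shape of both
    [canonical_weight] and [tangent_gaussian]. *)
Lemma density_measure : exists2 m : {measure set X -> \bar R},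
  (m : set X -> \bar R) = (fun A => \int[mu]_(x in A `&` D) (w x)%:E)%E &
  (forall f : X -> \bar R, measurable_fun setT f -> (forall x, 0 <= f x)%E ->
     \int[m]_x f x = \int[mu]_(x in D) ((w x)%:E * f x))%E.
Proof.
exists (mixture mu mD mk) => [|f mf f0].
  apply/funext => A; rewrite /= /mixture integral_mkcondl; apply: eq_integral => x _.
  transitivity ((w x)%:E * \d_x A)%E => //.
  by rewrite patchE diracE; case: ifP => _; [rewrite mule1|rewrite mule0].
rewrite integral_mixture//; apply: eq_integral => x _.
by rewrite ge0_integral_mscale// integral_dirac// diracT mul1e.
Qed.

End Density.

(** * Measurability of the tangent bundle and of its fibre measures *)

Section TangentBundle.
Variables (R : realType) (n m : nat) (g : 'I_m -> mpoly.mpoly n R).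

Local Notation E := ('cV[R]_n).
Local Notation M := (constraint_manifold g).
Local Notation TM := (tangent_bundle g).
Local Notation C := (constraint_jacobian g).

Lemma measurable_constraint_manifold : measurable M.
Proof.
have -> : M = \bigcap_(i in [set: 'I_m])
    (setT `&` (fun x : E => mpoly.meval (fun j => x j 0) (g i)) @^-1` [set 0]).
  apply/seteqP; split=> [x Mx i _|x Mx i]; first by split => //=; exact: Mx.
  by have [] := Mx i I.
by apply: fin_bigcap_measurable => // i _; apply: measurable_meval.
Qed.

Lemma measurable_constraint_jacobian : measurable_fun setT C.
Proof.
apply: measurable_mx => i j; under eq_fun do rewrite mxE.
exact: measurable_meval.
Qed.

Lemma measurable_tangent_space x : measurable (tangent_space g x).
Proof.
have := measurable_eq_mx measurableT (@measurable_mulmxl R _ _ 1 (C x)) (measurable_cst (0 : 'cV[R]_m)).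
by rewrite setTI.
Qed.

Lemma measurable_tangent_bundle : measurable TM.
Proof.
have mC : measurable_fun setT (fun z : E * E => C z.1 *m z.2).
  apply: measurable_mulmx; last exact: measurable_snd.
  exact: measurableT_comp measurable_constraint_jacobian measurable_fst.
have := measurable_eq_mx measurableT mC (measurable_cst (0 : 'cV[R]_m)); rewrite setTI.
apply: measurableI; rewrite -[X in measurable X]setTI.
by apply: measurable_fst => //; exact: measurable_constraint_manifold.
Qed.

Lemma measurable_tangent_frame x :
  measurable_fun setT (fun w : 'cV[R]_(n - m) => tangent_frame g x *m w).
Proof. exact: measurable_mulmxl. Qed.

Lemma tangent_lebesgueE x :
  tangent_lebesgue g x = image_measure (@lebesgue_cV R (n - m)) (measurable_tangent_frame x).
Proof. by []. Qed.

Let tangent_lebesgue0 x : tangent_lebesgue g x set0 = 0%E.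
Proof. by rewrite tangent_lebesgueE measure0. Qed.

Let tangent_lebesgue_ge0 x A : (0 <= tangent_lebesgue g x A)%E.
Proof. by rewrite tangent_lebesgueE. Qed.

Let tangent_lebesgue_semi_sigma_additive x :
  semi_sigma_additive (tangent_lebesgue g x).
Proof. by rewrite tangent_lebesgueE; exact: measure_semi_sigma_additive. Qed.

HB.instance Definition _ x := isMeasure.Build _ _ _ (tangent_lebesgue g x)
  (tangent_lebesgue0 x) (@tangent_lebesgue_ge0 x)
  (@tangent_lebesgue_semi_sigma_additive x).

Lemma ge0_integral_tangent_lebesgue x (f : E -> \bar R) :
  measurable_fun setT f -> (forall v, 0 <= f v)%E ->
  (\int[tangent_lebesgue g x]_v f v =
   \int[@lebesgue_cV R (n - m)]_w f (tangent_frame g x *m w))%E.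
Proof.
move=> mf f0; rewrite tangent_lebesgueE ge0_integral_pushforward//.
exact: measurable_tangent_frame.
Qed.

Hypothesis full_rank : forall x, M x -> \rank (C x) = m.

Lemma tangent_frameP x : M x ->
  C x *m tangent_frame g x = 0 /\ (tangent_frame g x)^T *m tangent_frame g x = 1%:M.
Proof.
move=> Mx; have mn : (m <= n)%N by rewrite -{1}(full_rank Mx) rank_leq_col.
have : (m + (n - m) <= n)%N by rewrite subnKC.
by move=> /(exists_orthonormal_kernel (C x))/getPex.
Qed.

Let P x := kernel_projector (C x).

Let measurable_P : measurable_fun setT P.
Proof.
have mC := measurable_constraint_jacobian.
have mG : measurable_fun setT (fun x => C x *m (C x)^T).
  by apply: measurable_mulmx => //; exact: measurable_trmx.
apply: measurable_mxB; first exact: measurable_cst.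
apply: measurable_mulmx => //; apply: measurable_mulmx; first exact: measurable_trmx.
apply: measurable_mxZ; last exact: measurable_adjugate.
have := measurableT_comp (@measurable_invr R) (measurable_det mG).
exact.
Qed.

Let measurable_slab (A : set (E * E)) : measurable A ->
  measurable_fun setT (fun x => lebesgue_cV [set u | A (x, P x *m u) /\ frame_slab (P x) u]).
Proof.
move=> mA.
have mPu : measurable_fun setT (fun p : E * E => P p.1 *m p.2).
  apply: measurable_mulmx; last exact: measurable_snd.
  exact: measurableT_comp measurable_P measurable_fst.
have mS : measurable [set p : E * E | A (p.1, P p.1 *m p.2) /\ frame_slab (P p.1) p.2].
  apply: measurableI; last first.
    by apply: measurable_sqnorm_le; apply: measurable_mxB => //; exact: measurable_snd.
  rewrite -[X in measurable X]setTI.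
  have mf : measurable_fun setT (fun p : E * E => (p.1, P p.1 *m p.2)).
    by apply: measurable_fun_pair => //; exact: measurable_fst.
  exact: mf.
have := measurable_fun_xsection (@lebesgue_cV R n) mS.
by congr (measurable_fun _ _); apply/funext => x; rewrite /= xsectionE.
Qed.

Lemma measurable_tangent_lebesgue_xsection (A : set (E * E)) : measurable A ->
  measurable_fun M (fun x => tangent_lebesgue g x (xsection A x)).
Proof.
(* With this [B] the denominator in [lebesgue_frame] takes the same form as the numerator, so
   [measurable_slab] covers both. *)
move=> mA; pose B := [set p : E * E | sqnorm p.2 <= 1].
have mB : measurable B by apply: measurable_sqnorm_le; exact: measurable_snd.
pose Num x := lebesgue_cV [set u | A (x, P x *m u) /\ frame_slab (P x) u].
pose Den x := lebesgue_cV [set u | B (x, P x *m u) /\ frame_slab (P x) u].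
apply: (@eq_measurable_fun _ _ _ _ _
  (fun x => ((fine (Den x))^-1)%:E * (lebesgue_cV (@euclidean_ball R (n - m)) * Num x))%E).
  move=> x /set_mem Mx; have [CQ QQ] := tangent_frameP Mx.
  rewrite /tangent_lebesgue (lebesgue_frame QQ); last exact: measurable_xsection.
  rewrite -(kernel_projectorE (full_rank Mx) CQ QQ) xsectionE.
  by [].
apply: measurable_funTS; apply: emeasurable_funM.
  apply/measurable_EFinP.
  have h : measurable_fun setT (fun x => fine (Den x)).
    by apply: (measurableT_comp (fine_measurable measurableT)); exact: measurable_slab.
  exact: measurableT_comp (@measurable_invr R) h.
apply: measurable_funeM.
exact: measurable_slab.
Qed.

End TangentBundle.

(** * The Liouville measure as a mixture over the manifold *)

Section Liouville.
Variables (R : realType) (n m : nat) (g : 'I_m -> mpoly.mpoly n R).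

Local Notation E := ('cV[R]_n).
Local Notation M := (constraint_manifold g).
Local Notation TM := (tangent_bundle g).
Local Notation C := (constraint_jacobian g).

Hypothesis full_rank : forall x, M x -> \rank (C x) = m.

Lemma tangent_lebesgueN x (B : set E) : measurable B ->
  tangent_lebesgue g x [set v | B (- v)] = tangent_lebesgue g x B.
Proof.
move=> mB; rewrite /tangent_lebesgue -[RHS]lebesgue_cVN.
  by congr (lebesgue_cV _); apply/seteqP; split => w /=; rewrite mulmxN.
by rewrite -[X in measurable X]setTI; apply: measurable_tangent_frame.
Qed.

Lemma ge0_integral_tangent_space x (f : E -> \bar R) : M x ->
  measurable_fun setT f -> (forall v, 0 <= f v)%E ->
  (\int[tangent_lebesgue g x]_(v in tangent_space g x) f v =
   \int[tangent_lebesgue g x]_v f v)%E.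
Proof.
move=> Mx mf f0; have [CQ _] := tangent_frameP full_rank Mx.
rewrite integral_mkcond !ge0_integral_tangent_lebesgue//.
- apply: eq_integral => w _; rewrite patchE mem_set//.
  by rewrite /tangent_space/= mulmxA CQ mul0mx.
- apply/(measurable_restrictT _ (measurable_tangent_space g x)).
  exact: measurable_funTS.
- by move=> v; exact: erestrict_ge0.
Qed.

Lemma measurable_gauss : measurable_fun setT (fun v : E => expR (- (sqnorm v / 2))).
Proof.
apply: measurableT_comp => //; apply: measurableT_comp => //.
by apply: measurable_funM => //; exact: (measurable_sqnorm (@measurable_id _ _ setT)).
Qed.

Lemma integral_gauss_tangent_lebesgue x : M x ->
  (\int[tangent_lebesgue g x]_v (expR (- (sqnorm v / 2)))%:E =
   (Num.sqrt (2 * pi) ^+ (n - m))%:E)%E.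
Proof.
move=> Mx; have [_ QQ] := tangent_frameP full_rank Mx.
rewrite ge0_integral_tangent_lebesgue//; last first.
  by apply/measurable_EFinP; exact: measurable_gauss.
by rewrite -integral_gauss; apply: eq_integral => w _; rewrite (sqnorm_isometry _ QQ).
Qed.

Let measurable_slice (x : E) : measurable_fun setT (fun v : E => (x, v)).
Proof. by apply: measurable_fun_pair; [exact: measurable_cst|exact: measurable_id]. Qed.

Let k x := image_measure (tangent_lebesgue g x) (measurable_slice x).

Let mk (A : set (E * E)) : measurable A -> measurable_fun M (fun x => k x A).
Proof.
move=> mA; have := measurable_tangent_lebesgue_xsection full_rank mA.
by congr (measurable_fun _ _); apply/funext => x; rewrite xsectionE.
Qed.

(** The fibre measures form a measurable kernel because of [full_rank], so [liouville] carries no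
    measure structure of its own. Rewriting with the equality to [lam] switches between the set
    function and the bundled measure. *)
Lemma liouville_mixture : exists2 lam : {measure set (E * E) -> \bar R},
  (lam : set (E * E) -> \bar R) = liouville g &
  forall f : E * E -> \bar R, measurable_fun setT f -> (forall z, 0 <= f z)%E ->
    measurable_fun M (fun x => \int[tangent_lebesgue g x]_v f (x, v))%E /\
    (\int[lam]_z f z =
     \int[@surface_measure R n m]_(x in M) \int[tangent_lebesgue g x]_v f (x, v))%E.
Proof.
have mM := measurable_constraint_manifold g.
exists (mixture (@surface_measure R n m) mM mk).
  by apply/funext => A; apply: eq_integral => x _; rewrite xsectionE.
move=> f mf f0.
have intk x : (\int[k x]_z f z = \int[tangent_lebesgue g x]_v f (x, v))%E.
  by rewrite ge0_integral_pushforward//; exact: measurable_slice.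
split.
  have := measurable_fun_integral_mixture mk mf f0.
  by congr (measurable_fun _ _); apply/funext => x; rewrite intk.
by rewrite integral_mixture//; apply: eq_integral => x _; rewrite intk.
Qed.

Lemma liouville_momentum_flip (A : set (E * E)) : measurable A ->
  liouville g [set z | A (momentum_flip z)] = liouville g A.
Proof.
move=> mA; apply: eq_integral => x _; rewrite !xsectionE.
rewrite -[RHS]tangent_lebesgueN//.
by rewrite -[X in measurable X]setTI; exact: measurable_slice.
Qed.

End Liouville.

(** * Volume preservation of a reversible trajectory map *)

Section ReversibleMap.
Variables (R : realType) (d : measure_display) (T : measurableType d).
Variables (lam : {measure set T -> \bar R}) (D : set T).
Hypothesis mD : measurable D.
(** The diagonal of an abstract measurable space may fail to be measurable; this substitute makes
    [G] and the images along the trajectory measurable. *)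
Hypothesis measurable_eq : forall f g : T -> T,
  measurable_fun D f -> measurable_fun D g -> measurable (D `&` [set x | f x = g x]).

Lemma measurable_iter (phi : T -> T) j :
  measurable_fun D phi -> (forall x, D x -> D (phi x)) ->
  measurable_fun D (iter j phi) /\ forall x, D x -> D (iter j phi x).
Proof.
move=> mphi Dphi; elim: j => [|j [mj Dj]]; first by split => //; exact: measurable_id.
split => [|x Dx]; last exact/Dphi/Dj.
by apply: (measurable_comp mD _ mphi mj) => _ [x Dx <-]; exact: Dj.
Qed.

Variables (phi N : T -> T) (L : nat).
Hypothesis mphi : measurable_fun D phi.
Hypothesis Dphi : forall x, D x -> D (phi x).
Hypothesis lam_phi : forall A B, measurable A -> measurable B ->
  A `<=` D -> B `<=` D -> set_bij A B phi -> lam A = lam B.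
Hypothesis mN : measurable_fun setT N.
Hypothesis DN : forall x, D x -> D (N x).
Hypothesis NK : involutive N.
Hypothesis lamN : forall A, measurable A -> lam [set x | A (N x)] = lam A.

Let f x := N (iter L phi x).

Let mf : measurable_fun D f.
Proof.
have [mi _] := measurable_iter L mphi Dphi.
exact: measurableT_comp mN mi.
Qed.

Let Df x : D x -> D (f x).
Proof. by move=> Dx; apply: DN; have [_] := measurable_iter L mphi Dphi; exact. Qed.

Let G := D `&` [set x | f (f x) = x].

Let mG : measurable G.
Proof.
apply: measurable_eq; last exact: measurable_id.
by apply: (measurable_comp mD _ mf mf) => _ [x Dx <-]; exact: Df.
Qed.

Let Gf x : G x -> G (f x).
Proof. by move=> [Dx /= fx]; split; [exact: Df|rewrite /= fx]. Qed.

(* The inverse of iter k phi on the image of G is f \o N \o iter (L - k) phi,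
   hence images of measurable subsets of G are measurable. *)
Let measurable_image_iter (B : set T) k : (k <= L)%N -> measurable B -> B `<=` G ->
  measurable (iter k phi @` B).
Proof.
move=> kL mB BG; pose r x := f (N (iter (L - k) phi x)).
have [mi Di] := measurable_iter (L - k) mphi Dphi.
have [mk Dk] := measurable_iter k mphi Dphi.
have Dr x : D x -> D (r x) by move=> Dx; exact/Df/DN/Di.
have mr : measurable_fun D r.
  have mNi : measurable_fun D (fun x => N (iter (L - k) phi x)) by exact: measurableT_comp mN mi.
  by apply: (measurable_comp mD _ mf mNi) => _ [x Dx <-]; exact/DN/Di.
have rK x : B x -> r (iter k phi x) = x.
  by move=> /BG[_ /= fx]; rewrite /r -iterD subnK.
have -> : iter k phi @` B = (D `&` r @^-1` B) `&` (D `&` [set x | iter k phi (r x) = x]).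
  apply/seteqP; split=> [_ [x Bx <-]|x [[Dx /= Brx] [_ /= kx]]]; last by exists (r x).
  have Dkx : D (iter k phi x) by apply: Dk; have [] := BG _ Bx.
  by split; split => //=; rewrite rK.
apply: measurableI; first exact: mr.
apply: measurable_eq; last exact: measurable_id.
by apply: (measurable_comp mD _ mk mr) => _ [x Dx <-]; exact: Dr.
Qed.

Let lam_image_iter (B : set T) k : (k <= L)%N -> measurable B -> B `<=` G ->
  lam (iter k phi @` B) = lam B.
Proof.
move=> + mB BG; elim: k => [_|k IH kL].
  by congr (lam _); apply/seteqP; split=> [_ [x Bx <-]|x Bx] //; exists x.
transitivity (lam (iter k phi @` B)); last by apply: IH; exact: ltnW.
symmetry; apply: (@lam_phi (iter k phi @` B) (iter k.+1 phi @` B)).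
- by apply: measurable_image_iter => //; exact: ltnW.
- exact: measurable_image_iter.
- move=> _ [x Bx <-]; have [_] := measurable_iter k mphi Dphi; apply.
  by have [] := BG _ Bx.
- move=> _ [x Bx <-]; have [_] := measurable_iter k.+1 mphi Dphi; apply.
  by have [] := BG _ Bx.
split.
- by move=> _ [x Bx <-]; exists x.
- move=> _ _ /set_mem[x Bx <-] /set_mem[y By <-] xy.
  (* Injectivity of the next step: completing the trajectory, flipping, and running [f] once more
     returns to the starting point. *)
  have fK z : B z -> f (N (iter (L - k.+1) phi (iter k.+1 phi z))) = z.
    by move=> /BG[_ fz]; rewrite -[RHS]fz -iterD subnK.
  by rewrite -(fK x Bx) -(fK y By) /= xy.
- by move=> _ [x Bx <-]; exists (iter k phi x) => //; exists x.
Qed.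

Lemma reversible_preserves (F : T -> T) (A : set T) :
  (forall x, G x -> F x = f x) -> (forall x, D x -> ~ G x -> F x = x) ->
  measurable A -> A `<=` D -> lam (D `&` F @^-1` A) = lam A.
Proof.
move=> FG FnG mA AD.
pose B := G `&` [set x | A (f x)].
have mB : measurable B.
  have -> : B = G `&` (D `&` f @^-1` A).
    by apply/seteqP; split=> x [Gx]; [move=> Ax; split=> //; split=> //; case: Gx|move=> []].
  by apply: measurableI => //; exact: mf.
have BG : B `<=` G by move=> x [].
have -> : D `&` F @^-1` A = B `|` (A `\` G).
  apply/seteqP; split=> [x [Dx /= AFx]|x [[Gx /= Afx]|[Ax nGx]]].
  - have [Gx|nGx] := pselect (G x); [left|right]; split=> //=.
      by rewrite -FG.
    by rewrite -(FnG x).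
  - by split; [case: Gx|rewrite /= FG].
  - by split; [exact: AD|rewrite /= FnG//; exact: AD].
have -> : lam A = lam (A `&` G) + lam (A `\` G).
  rewrite -measureU ?setUIDK//; [exact: measurableI|exact: measurableD|].
  by rewrite setIDA; apply/seteqP; split=> x // [[[_ ?] _]].
rewrite measureU//; last 2 first.
- exact: measurableD.
- by apply/seteqP; split=> x // [[Gx _] [_]].
congr (_ + _)%E; transitivity (lam (iter L phi @` B)).
  by rewrite (@lam_image_iter B L (leqnn L) mB BG).
rewrite -(lamN (measurable_image_iter (leqnn L) mB BG)); congr (lam _).
apply/seteqP; split=> [x [y [Gy Afy] yx]|x [Ax Gx]].
  have -> : x = f y by rewrite /f yx NK.
  by split=> //; exact: Gf.
have [_ /= ffx] := Gx.
by exists (f x); [split; [exact: Gf|rewrite /= ffx]|rewrite -[in RHS]ffx /f NK].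
Qed.

End ReversibleMap.

Lemma measurable_fun_pair_in d d1 d2 (T : measurableType d) (T1 : measurableType d1)
    (T2 : measurableType d2) (D : set T) (f : T -> T1) (h : T -> T2) :
  measurable_fun D f -> measurable_fun D h -> measurable_fun D (fun x => (f x, h x)).
Proof.
move=> mf mh mD; suff : measurable_fun D (fun x => (f x, h x)) by exact.
apply: (measurability _ (measurable_prod_measurableType T1 T2)).
move=> _ [_ [A mA [B mB <-]] <-].
have -> : D `&` (fun x => (f x, h x)) @^-1` (A `*` B) = (D `&` f @^-1` A) `&` (D `&` h @^-1` B).
  by apply/seteqP; split=> [x [Dx [/= Afx Bhx]]|x [[Dx Afx] [_ Bhx]]].
by apply: measurableI; [exact: mf|exact: mh].
Qed.

(** * Joint measurability of the proposal in duration and state *)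

Section Proposal.
Variables (R : realType) (n m : nat) (g : 'I_m -> mpoly.mpoly n R).

Local Notation E := ('cV[R]_n).
Local Notation TM := (tangent_bundle g).

Variables (Phi : R -> E * E -> E * E) (dt_max : R).
Hypothesis dt_max_gt0 : 0 < dt_max.

Lemma ceil_steps_gt0 (T : R) : 0 < T -> (0 < Num.ceil (T / dt_max))%R.
Proof. by move=> T0; rewrite ltNge ceil_le0 -ltNge divr_gt0. Qed.

Lemma nstepsE (T : R) : 0 < T -> (nsteps dt_max T)%:Z = Num.ceil (T / dt_max).
Proof. by move=> /ceil_steps_gt0 T0; rewrite /nsteps gez0_abs// ltW. Qed.

Lemma nsteps_gt0 (T : R) : 0 < T -> (0 < nsteps dt_max T)%N.
Proof. by move=> T0; rewrite -ltz_nat nstepsE// ceil_steps_gt0. Qed.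

Lemma step_size_bounds (T : R) : 0 < T ->
  0 < T / (nsteps dt_max T)%:R <= dt_max.
Proof.
move=> T0; have k0 : 0 < (nsteps dt_max T)%:R :> R by rewrite ltr0n nsteps_gt0.
rewrite divr_gt0//= ler_pdivrMr// mulrC -ler_pdivrMr//.
by rewrite pmulrn nstepsE// ceil_ge.
Qed.

Lemma measurable_nsteps k : measurable [set T : R | 0 < T /\ nsteps dt_max T = k].
Proof.
have -> : [set T : R | 0 < T /\ nsteps dt_max T = k] =
    `]0, +oo[%classic `&` (setT `&` (fun T : R => T / dt_max) @^-1` `](k%:Z - 1)%:~R, k%:Z%:~R]).
  apply/seteqP; split=> [T /= [T0 Tk]|T /= [+ [_]]]; rewrite !in_itv/= andbT.
    by rewrite -ceil_eq -nstepsE// Tk eqxx T0.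
  by move=> T0; rewrite -ceil_eq -nstepsE// => /eqP[].
apply: measurableI => //.
have mdiv : measurable_fun setT (fun T : R => T / dt_max) by exact: measurable_funM.
by apply: mdiv => //; exact: measurable_itv.
Qed.

Lemma measurable_eq_pair d (T : measurableType d) (D : set T) (f h : T -> E * E) :
  measurable D -> measurable_fun D f -> measurable_fun D h ->
  measurable (D `&` [set x | f x = h x]).
Proof.
move=> mD mf mh.
have -> : D `&` [set x | f x = h x] =
    (D `&` [set x | (f x).1 = (h x).1]) `&` (D `&` [set x | (f x).2 = (h x).2]).
  apply/seteqP; split=> [x [Dx /= fh]|x [[Dx /= fh1] [_ /= fh2]]].
    by rewrite /= fh.
  by split => //=; rewrite [f x]surjective_pairing fh1 fh2 -surjective_pairing.
by apply: measurableI; apply: measurable_eq_mx => //;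
  first [exact: measurableT_comp measurable_fst _ | exact: measurableT_comp measurable_snd _].
Qed.

Lemma measurable_momentum_flip : measurable_fun setT (@momentum_flip R n).
Proof.
apply: measurable_fun_pair_in; first exact: measurable_fst.
by apply: measurable_mxN; exact: measurable_snd.
Qed.

Lemma momentum_flipK : involutive (@momentum_flip R n).
Proof. by move=> [x v]; rewrite /momentum_flip/= opprK. Qed.

Lemma tangent_bundle_momentum_flip z : TM z -> TM (momentum_flip z).
Proof. by move=> [Mz Tz]; split => //; rewrite /tangent_space/= mulmxN Tz oppr0. Qed.

Hypothesis Phi_TM : forall dt z, 0 < dt <= dt_max -> TM z -> TM (Phi dt z).
Hypothesis Phi_measurable : measurable_fun (`]0, dt_max] `*` TM)
  (fun p : R * (E * E) => Phi p.1 p.2).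

Let mTM : measurable TM := measurable_tangent_bundle g.

(** On each slice the number of steps is the constant [k], so the trajectory is a fixed composition
    of maps; countably many slices exhaust the positive durations. *)
Let Dk k : set (R * (E * E)) := [set T : R | 0 < T /\ nsteps dt_max T = k] `*` TM.

Let mDk k : measurable (Dk k).
Proof. by apply: measurableX => //; exact: measurable_nsteps. Qed.

(** The two claims go together: [Phi] is measurable on step sizes in []0, dt_max]] and states in
    [TM], so composing once more requires that the previous iterate stay in [TM]. *)
Let measurable_iter_Phi k j :
  measurable_fun (Dk k) (fun p : R * (E * E) => iter j (Phi (p.1 / k%:R)) p.2) /\
  forall p, Dk k p -> TM (iter j (Phi (p.1 / k%:R)) p.2).
Proof.
elim: j => [|j [mj Tj]]; first by split=> [|p []//]; exact: measurable_funTS measurable_snd.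
have bd p : Dk k p -> 0 < p.1 / k%:R <= dt_max.
  by move=> [[p0 <-] _]; exact: step_size_bounds.
split=> [|p Dp]; last by apply: Phi_TM; [exact: bd|exact: Tj].
have mf : measurable_fun (Dk k) (fun p : R * (E * E) => (p.1 / k%:R, iter j (Phi (p.1 / k%:R)) p.2)).
  apply: measurable_fun_pair_in => //.
  by apply: measurable_funM => //; exact: measurable_funTS measurable_fst.
apply: (measurable_comp _ _ Phi_measurable mf).
  by apply: measurableX => //; exact: measurable_itv.
by move=> _ [p Dp <-]; split; [rewrite /= in_itv/= bd|exact: Tj].
Qed.

Definition positive_time : set (R * (E * E)) := [set p | 0 < p.1 /\ TM p.2].

Lemma positive_timeE : positive_time = \bigcup_k Dk k.
Proof.
apply/seteqP; split=> [p [p0 Tp]|p [k _ [[p0 _] Tp]]]; last by [].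
by exists (nsteps dt_max p.1).
Qed.

Lemma measurable_positive_time : measurable positive_time.
Proof. by rewrite positive_timeE; exact: bigcupT_measurable. Qed.

Local Notation ft := (flipped_trajectory Phi dt_max).

Lemma measurable_flipped_trajectory :
  measurable_fun positive_time (fun p : R * (E * E) => ft p.1 p.2).
Proof.
rewrite positive_timeE; apply/measurable_fun_bigcup => // k.
apply: (@eq_measurable_fun _ _ _ _ _
  (fun p : R * (E * E) => momentum_flip (iter k (Phi (p.1 / k%:R)) p.2))).
  by move=> p /set_mem[[p0 pk] _]; rewrite /flipped_trajectory pk.
have [mk _] := measurable_iter_Phi k k.
exact: measurableT_comp measurable_momentum_flip mk.
Qed.

Lemma tangent_bundle_flipped_trajectory (T : R) z : 0 < T -> TM z -> TM (ft T z).
Proof.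
move=> T0 Tz; apply: tangent_bundle_momentum_flip.
have [_ Tk] := measurable_iter_Phi (nsteps dt_max T) (nsteps dt_max T).
by apply: (Tk (T, z)); split.
Qed.

Variable check : bool.
Local Notation prop := (proposal Phi dt_max check).

Lemma measurable_proposal :
  measurable_fun positive_time (fun p : R * (E * E) => prop p.1 p.2).
Proof.
have mD := measurable_positive_time; have mft := measurable_flipped_trajectory.
have mz : measurable_fun positive_time (fun p : R * (E * E) => p.2).
  exact: measurable_funTS measurable_snd.
have mftft : measurable_fun positive_time (fun p : R * (E * E) => ft p.1 (ft p.1 p.2)).
  have mp : measurable_fun positive_time (fun p : R * (E * E) => (p.1, ft p.1 p.2)).
    by apply: measurable_fun_pair_in => //; exact: measurable_funTS measurable_fst.
  apply: (measurable_comp mD _ mft mp) => _ [p [p0 Tp] <-]; split => //=.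
  exact: tangent_bundle_flipped_trajectory.
apply: measurable_fun_if => //; last 2 first.
- by apply: measurable_funS mz => //; exact: subIsetl.
- by apply: measurable_funS mft => //; exact: subIsetl.
(* The test is [false] where a second run returns to the initial state, an equalizer of measurable
   maps, and everywhere if the check is omitted. *)
apply: (measurable_fun_bool false).
case: (check); last by rewrite /= (_ : _ @^-1` _ = setT) ?setIT//; apply/seteqP; split.
have := measurable_eq_pair mD mftft mz.
congr (measurable _); apply/seteqP; split=> p [p0 /=] h; split=> //=; first by rewrite h eqxx.
by apply/eqP/negPn/negP => /negPf nh; move: h; rewrite nh.
Qed.

Lemma tangent_bundle_proposal (T : R) z : 0 < T -> TM z -> TM (prop T z).
Proof.
by move=> T0 Tz; rewrite /proposal; case: ifP => // _; exact: tangent_bundle_flipped_trajectory.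
Qed.

Hypothesis full_rank : forall x, constraint_manifold g x -> \rank (constraint_jacobian g x) = m.
Hypothesis Phi_volume : forall dt, 0 < dt <= dt_max -> liouville_preserving g (Phi dt).
Hypothesis reversible : forall T z, 0 < T -> TM z -> prop T (prop T z) = z.

Lemma liouville_proposal (T : R) (A : set (E * E)) : 0 < T -> measurable A -> A `<=` TM ->
  liouville g (TM `&` prop T @^-1` A) = liouville g A.
Proof.
move=> T0 mA ATM; have [lam lamE _] := liouville_mixture full_rank.
have bd := step_size_bounds T0; set dt := T / _ in bd.
have mphi : measurable_fun TM (Phi dt).
  have mp : measurable_fun TM (fun z : E * E => (dt, z)).
    by apply: measurable_fun_pair_in; [exact: measurable_cst|exact: measurable_id].
  apply: (measurable_comp _ _ Phi_measurable mp).
    by apply: measurableX => //; exact: measurable_itv.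
  by move=> _ [z Tz <-]; split => //=; rewrite in_itv.
rewrite -lamE.
apply: (@reversible_preserves _ _ _ lam TM mTM _ (Phi dt) (@momentum_flip R n) (nsteps dt_max T)) => //.
- by move=> f h mf mh; exact: measurable_eq_pair.
- by move=> z; exact: Phi_TM.
- by move=> B B' mB mB' BT B'T Bphi; rewrite lamE; exact: Phi_volume Bphi.
- exact: measurable_momentum_flip.
- exact: tangent_bundle_momentum_flip.
- exact: momentum_flipK.
- by move=> B mB; rewrite lamE; exact: liouville_momentum_flip.
- move=> z [Tz /= zz]; rewrite /proposal.
  by rewrite [X in X != z](_ : _ = z)// eqxx andbF.
(* With the check, a state outside the involutive set is its own proposal. Without it, reversibility
   says that this set is all of [TM]. *)
- move=> z Tz nG; rewrite /proposal; case: ifP => // /negbT.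
  rewrite negb_and negbK => /orP[nc|/eqP zz]; last by exfalso; apply: nG.
  exfalso; apply: nG; split => //=; have := reversible T0 Tz.
  by rewrite /proposal (negPf nc).
Qed.

End Proposal.

(** * Detailed balance for a measure-preserving involution *)

Section Metropolis.
Variables (R : realType) (d : measure_display) (X : measurableType d).
Variables (lam : {measure set X -> \bar R}) (D : set X) (F : X -> X).
Hypothesis mD : measurable D.
Hypothesis mF : measurable_fun D F.
Hypothesis DF : forall x, D x -> D (F x).
Hypothesis lamF : forall A, measurable A -> A `<=` D -> lam (D `&` F @^-1` A) = lam A.

(** [F] is measurable on [D] only, so its image measure is built as a mixture over [D] of Dirac
    masses at [F x] rather than as a pushforward. *)
Lemma integral_preserving_map (h : X -> \bar R) : measurable_fun D h ->
  (forall x, D x -> 0 <= h x)%E ->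
  (\int[lam]_(x in D) h (F x) = \int[lam]_(x in D) h x)%E.
Proof.
move=> mh h0.
pose k x : {measure set X -> \bar R} := \d_(F x).
have kE A x : k x A = (\1_(F @^-1` A) x)%:E by [].
have mk A : measurable A -> measurable_fun D (fun x => k x A).
  move=> mA; apply/measurable_EFinP.
  apply: (eq_measurable_fun (fun x => \1_(D `&` F @^-1` A) x : R)).
    by move=> x xD; rewrite !indicE in_setI xD.
  by apply: measurable_funTS; apply: measurable_indic; exact: mF.
have mhD : measurable_fun setT (h \_ D) by exact/(measurable_restrictT _ mD).
have hD0 x : (0 <= (h \_ D) x)%E by exact: erestrict_ge0.
transitivity (\int[mixture lam mD mk]_(x in D) h x)%E.
  rewrite [RHS]integral_mkcond integral_mixture//; apply: eq_integral => x /set_mem Dx.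
  by rewrite /k integral_dirac// diracT mul1e patchE mem_set//; exact: DF.
apply: eq_measure_integral => A mA AD; rewrite /= /mixture.
have mFA : measurable (D `&` F @^-1` A) by exact: mF.
rewrite -[RHS]lamF//.
have -> : D `&` F @^-1` A = (D `&` F @^-1` A) `&` D by rewrite setIAC setIid.
rewrite -integral_indic//.
by apply: eq_integral => x xD; rewrite kE !indicE in_setI xD.
Qed.

Variables (H : X -> R) (c : R).
Hypothesis mH : measurable_fun D H.
Hypothesis c0 : 0 <= c.
Hypothesis FK : forall x, D x -> F (F x) = x.

Lemma detailed_balance (A : set X) : measurable A ->
  (\int[lam]_(x in D) ((c * expR (- H x))%:E *
     (Num.min 1 (expR (H x - H (F x))) * \1_A (F x) +
      (1 - Num.min 1 (expR (H x - H (F x)))) * \1_A x)%:E) =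
   \int[lam]_(x in A `&` D) (c * expR (- H x))%:E)%E.
Proof.
move=> mA.
pose w x := c * expR (- H x).
pose s x := c * Num.min (expR (- H x)) (expR (- H (F x))).
have mHF : measurable_fun D (fun x => H (F x)).
  by apply: (measurable_comp mD _ mH mF) => _ [x Dx <-]; exact: DF.
have mexp (f : X -> R) : measurable_fun D f -> measurable_fun D (fun x => expR (- f x)).
  by move=> mf; apply: measurableT_comp => //; exact: measurableT_comp.
have mw : measurable_fun D w by apply: measurable_funM => //; exact: mexp.
have ms : measurable_fun D s.
  by apply: measurable_funM => //; apply: measurable_minr; exact: mexp.
have s0 x : 0 <= s x by rewrite mulr_ge0// le_min !expR_ge0.
have sw x : s x <= w x by rewrite ler_wpM2l// ge_min lexx.
have sF x : D x -> s (F x) = s x by move=> Dx; rewrite /s FK// minC.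
have m1 : measurable_fun D (\1_A : X -> R) by apply: measurable_funTS; exact: measurable_indic.
have m1F : measurable_fun D (fun x => \1_A (F x) : R).
  by apply: (measurable_comp mD _ m1 mF) => _ [x Dx <-]; exact: DF.
have i0 (x : X) : 0 <= \1_A x :> R by rewrite indicE.
(* The accepted mass [s] moves to [F x] and the rejected mass [w - s] stays. As [s] is invariant
   under [F], the moved part may be put back at [x], and the two add up to [w]. *)
transitivity (\int[lam]_(x in D) ((s x * \1_A (F x))%:E + ((w x - s x) * \1_A x)%:E))%E.
  apply: eq_integral => x _; rewrite -EFinM -EFinD; congr (_%:E).
  have -> : s x = w x * Num.min 1 (expR (H x - H (F x))).
    rewrite /w /s -mulrA; congr (c * _).
    rewrite minr_pMr ?expR_ge0// mulr1 -expRD.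
    by congr (Num.min _ (expR _)); ring.
  by rewrite /w; ring.
rewrite ge0_integralD//; last 4 first.
- by move=> x _; rewrite lee_fin mulr_ge0.
- by apply/measurable_EFinP; exact: measurable_funM.
- by move=> x _; rewrite lee_fin mulr_ge0// subr_ge0.
- by apply/measurable_EFinP; apply: measurable_funM => //; exact: measurable_funB.
have -> : (\int[lam]_(x in D) (s x * \1_A (F x))%:E = \int[lam]_(x in D) (s x * \1_A x)%:E)%E.
  rewrite -[RHS]integral_preserving_map.
  - by apply: eq_integral => x /set_mem Dx; rewrite sF.
  - by apply/measurable_EFinP; exact: measurable_funM.
  - by move=> x _; rewrite lee_fin mulr_ge0.
rewrite -ge0_integralD//; last 4 first.
- by move=> x _; rewrite lee_fin mulr_ge0.
- by apply/measurable_EFinP; exact: measurable_funM.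
- by move=> x _; rewrite lee_fin mulr_ge0// subr_ge0.
- by apply/measurable_EFinP; apply: measurable_funM => //; exact: measurable_funB.
rewrite integral_mkcondl; apply: eq_integral => x _.
rewrite -EFinD -mulrDl addrC subrK patchE indicE.
by case: ifP => _; rewrite ?mulr1 ?mulr0.
Qed.

End Metropolis.

(** * Probability structures for the target and the durations *)

Section ProbabilityCopy.
Variables (R : realType) (d : measure_display) (T : measurableType d).

Definition probability_copy (mu : {measure set T -> \bar R}) (mu1 : mu setT = 1%E) :
  set T -> \bar R := mu.

HB.instance Definition _ (mu : {measure set T -> \bar R}) (mu1 : mu setT = 1%E) :=
  Measure.on (probability_copy mu1).
HB.instance Definition _ (mu : {measure set T -> \bar R}) (mu1 : mu setT = 1%E) :=
  Measure_isProbability.Build _ _ _ (probability_copy mu1) mu1.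

End ProbabilityCopy.

Definition exponential_probability (R : realType) (rate : R) (rate_gt0 : 0 < rate) :
  probability (g_sigma_algebraType (R.-ocitv.-measurable)) R.
Proof.
refine (exponential_prob rate : probability _ R); exact: rate_gt0.
Defined.

(** Durations range over the open half-line, where reversibility is available; no mass is lost since
    the density vanishes on negative numbers and a point is negligible. *)
Lemma exponential_prob_gt0 (R : realType) (rate : R) : 0 < rate ->
  exponential_prob rate `]0, +oo[ = 1%E.
Proof.
move=> rate0; have pdf0 x : (0 <= (exponential_pdf rate x)%:E)%E.
  by rewrite lee_fin exponential_pdf_ge0// ltW.
have mpdf : measurable_fun setT (fun x => (exponential_pdf rate x)%:E).
  by apply/measurable_EFinP; exact: measurable_exponential_pdf.
rewrite -(integral_exponential_pdf rate0) -[in RHS](setUv `]0, +oo[%classic).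
rewrite ge0_integral_setU//=; last 3 first.
- exact: measurableC.
- by rewrite setUv.
- exact/disj_setPCl.
rewrite setCitvr -(@setUitv1 _ _ _ _ true)// ge0_integral_setU//=; last 2 first.
- exact: measurable_funTS.
- by rewrite disj_set_sym; apply/disj_setPLR => x /= ->; rewrite in_itv/= ltxx.
rewrite integral_set1 adde0 [X in (_ + X)%E]integral0_eq ?adde0// => x /=.
by rewrite in_itv/= => x0; rewrite lt0_exponential_pdf.
Qed.

(** * The canonical measure and velocity resampling *)

Section Canonical.
Variables (R : realType) (n m : nat) (g : 'I_m -> mpoly.mpoly n R).

Local Notation E := ('cV[R]_n).
Local Notation M := (constraint_manifold g).
Local Notation TM := (tangent_bundle g).
Local Notation S := (@surface_measure R n m).
Local Notation tl := (tangent_lebesgue g).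
Local Notation Tx := (tangent_space g).

Hypothesis full_rank : forall x, M x -> \rank (constraint_jacobian g x) = m.

(** Continuity is known at points of [D] only, so the preimage of an interval need not be open; but
    within [D] it coincides with its interior. *)
Lemma measurable_continuous_at (D : set E) (U : E -> R) : measurable D ->
  (forall x, D x -> {for x, continuous U}) -> measurable_fun D U.
Proof.
move=> mD cU; apply: (measurability _ (RGenOpens.measurableE R)).
move=> _ [_ [a [b ->] <-]].
have -> : D `&` U @^-1` `]a, b[ = D `&` (U @^-1` `]a, b[)°.
  apply/seteqP; split=> x [Dx Ux]; split=> //; last exact: interior_subset Ux.
  apply: (cU x Dx); apply: open_nbhs_nbhs; split => //; exact: interval_open.
by apply: measurableI => //; apply: sub_sigma_algebra; exact: open_interior.
Qed.

Lemma integral_liouville (f : E * E -> \bar R) : measurable_fun TM f ->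
  (forall z, TM z -> 0 <= f z)%E ->
  measurable_fun M (fun x => \int[tl x]_(v in Tx x) f (x, v))%E /\
  (\int[liouville g]_(z in TM) f z = \int[S]_(x in M) \int[tl x]_(v in Tx x) f (x, v))%E.
Proof.
move=> mf f0; have [lam lamE lam_int] := liouville_mixture full_rank.
have mTM := measurable_tangent_bundle g.
have mfT : measurable_fun setT (f \_ TM) by exact/(measurable_restrictT _ mTM).
have fT0 z : (0 <= (f \_ TM) z)%E by exact: erestrict_ge0.
have [mF intF] := lam_int _ mfT fT0.
have inner x : M x -> (\int[tl x]_v (f \_ TM) (x, v) = \int[tl x]_(v in Tx x) f (x, v))%E.
  move=> Mx; rewrite [RHS]integral_mkcond; apply: eq_integral => v _.
  rewrite !patchE; congr (if _ then _ else _).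
  by apply/idP/idP => /set_mem h; apply/mem_set; [case: h|split].
split.
  by apply: eq_measurable_fun mF => x /set_mem Mx; exact: inner.
rewrite -lamE integral_mkcond intF; apply: eq_integral => x /set_mem Mx.
exact: inner.
Qed.

Lemma tangent_gaussian_measure x : exists2 nu : {measure set E -> \bar R},
  (nu : set E -> \bar R) = tangent_gaussian g x &
  forall f : E -> \bar R, measurable_fun setT f -> (forall v, 0 <= f v)%E ->
    (\int[nu]_v f v = \int[tl x]_(v in Tx x) ((gaussian_density m v)%:E * f v))%E.
Proof.
have gd0 (v : E) : 0 <= gaussian_density m v.
  by rewrite mulr_ge0 ?expR_ge0// invr_ge0 exprn_ge0// sqrtr_ge0.
have mgd : measurable_fun (Tx x) (@gaussian_density R n m).
  by apply: measurable_funTS; apply: measurable_funM => //; exact: measurable_gauss.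
exact: density_measure (measurable_tangent_space g x) mgd gd0.
Qed.

Lemma integral_tangent_gaussian x (f : E -> \bar R) :
  measurable_fun setT f -> (forall v, 0 <= f v)%E ->
  (\int[tangent_gaussian g x]_(v in Tx x) f v =
   \int[tl x]_(v in Tx x) ((gaussian_density m v)%:E * f v))%E.
Proof.
move=> mf f0; have mT := measurable_tangent_space g x.
have [nu <- nu_int] := tangent_gaussian_measure x.
rewrite integral_mkcond nu_int.
- by apply: eq_integral => v vT; rewrite patchE vT.
- by apply/(measurable_restrictT _ mT); exact: measurable_funTS.
- by move=> v; exact: erestrict_ge0.
Qed.

Lemma tangent_gaussian_integral_ge0 x (f : E -> \bar R) :
  (forall v, 0 <= f v)%E -> (0 <= \int[tangent_gaussian g x]_(v in Tx x) f v)%E.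
Proof.
by move=> f0; have [nu <- _] := tangent_gaussian_measure x; exact: integral_ge0.
Qed.

Lemma eq_integral_tangent_gaussian x (f h : E -> \bar R) :
  (forall v, Tx x v -> f v = h v) ->
  (\int[tangent_gaussian g x]_(v in Tx x) f v = \int[tangent_gaussian g x]_(v in Tx x) h v)%E.
Proof.
move=> fh; have [nu <- _] := tangent_gaussian_measure x.
by apply: eq_integral => v /set_mem; exact: fh.
Qed.

Variable U : E -> R.
Hypothesis mU : measurable_fun M U.

Lemma measurable_hamiltonian : measurable_fun TM (hamiltonian U).
Proof.
apply: measurable_funD.
  have mz1 : measurable_fun TM (fun z : E * E => z.1) by exact: measurable_funTS measurable_fst.
  apply: (measurable_comp (measurable_constraint_manifold g) _ mU mz1).
  by move=> _ [z [Mz _] <-].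
apply: measurable_funM => //; apply: measurable_funTS.
exact: measurable_sqnorm measurable_snd.
Qed.

Let c0 : R := Num.sqrt (2 * pi) ^+ (n - m).

Lemma gauss_normalization_gt0 : 0 < c0.
Proof. by rewrite exprn_gt0// sqrtr_gt0 mulr_gt0// pi_gt0. Qed.

Lemma expR_hamiltonian x (v : E) :
  expR (- hamiltonian U (x, v)) = expR (- U x) * expR (- (sqnorm v / 2)).
Proof. by rewrite /hamiltonian/= opprD expRD. Qed.

Lemma integral_gauss_tangent_space x : M x ->
  (\int[tl x]_(v in Tx x) (expR (- (sqnorm v / 2)))%:E = c0%:E)%E.
Proof.
move=> Mx; rewrite ge0_integral_tangent_space//.
  exact: integral_gauss_tangent_lebesgue.
by apply/measurable_EFinP; exact: measurable_gauss.
Qed.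

Lemma measurable_expR_hamiltonian : measurable_fun TM (fun z => expR (- hamiltonian U z)).
Proof.
by apply: measurableT_comp => //; apply: measurableT_comp => //; exact: measurable_hamiltonian.
Qed.

(** Every fibre contributes the same Gaussian factor, so positivity and finiteness of the
    normalizing constant follow from those of the position integral. *)
Lemma canonical_weight_total :
  (canonical_weight g U TM = c0%:E * \int[S]_(x in M) (expR (- U x))%:E)%E.
Proof.
have mM := measurable_constraint_manifold g.
rewrite /canonical_weight setIid.
have [|z _|_ ->] := @integral_liouville (fun z => (expR (- hamiltonian U z))%:E).
- by apply/measurable_EFinP; exact: measurable_expR_hamiltonian.
- by rewrite lee_fin expR_ge0.
rewrite -ge0_integralZl//; last 2 first.
- apply/measurable_EFinP; apply: measurableT_comp => //; exact: measurableT_comp.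
- by rewrite lee_fin ltW// gauss_normalization_gt0.
apply: eq_integral => x /set_mem Mx.
under eq_integral do rewrite expR_hamiltonian EFinM.
have mT := measurable_tangent_space g x.
rewrite (ge0_integralZl _ mT)//; last first.
  by apply/measurable_EFinP; apply: measurable_funTS; exact: measurable_gauss.
by rewrite integral_gauss_tangent_space// muleC.
Qed.

Variable c : R.
Hypothesis c_ge0 : 0 <= c.
Let w z := c * expR (- hamiltonian U z).

(* Integrating out the velocity against its own conditional distribution
   leaves integrals against the canonical measure unchanged. *)
Lemma resample_velocity (f : E * E -> \bar R) : measurable_fun setT f ->
  (forall z, 0 <= f z)%E ->
  measurable_fun M (fun x => \int[tangent_gaussian g x]_(v in Tx x) f (x, v))%E /\
  (\int[liouville g]_(z in TM) ((w z)%:E *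
     \int[tangent_gaussian g z.1]_(v in Tx z.1) f (z.1, v)) =
   \int[liouville g]_(z in TM) ((w z)%:E * f z))%E.
Proof.
move=> mf f0; have mM := measurable_constraint_manifold g.
have w0 z : (0 <= (w z)%:E)%E by rewrite lee_fin mulr_ge0// expR_ge0.
have mw : measurable_fun TM (fun z => (w z)%:E).
  by apply/measurable_EFinP; apply: measurable_funM => //; exact: measurable_expR_hamiltonian.
have mfx x : measurable_fun setT (fun v => f (x, v)).
  apply: (measurableT_comp mf); apply: measurable_fun_pair => //; exact: measurable_cst.
have gd0 (v : E) : (0 <= (gaussian_density m v)%:E :> \bar R)%E.
  by rewrite lee_fin mulr_ge0 ?expR_ge0// invr_ge0 exprn_ge0// sqrtr_ge0.
have mgd : measurable_fun setT (fun v : E => (gaussian_density m v)%:E : \bar R).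
  by apply/measurable_EFinP; apply: measurable_funM => //; exact: measurable_gauss.
pose h x := (\int[tangent_gaussian g x]_(v in Tx x) f (x, v))%E.
have hE x : M x -> h x = (\int[tl x]_(v in Tx x) ((gaussian_density m v)%:E * f (x, v)))%E.
  by move=> Mx; apply: integral_tangent_gaussian.
have h0 x : M x -> (0 <= h x)%E.
  by move=> Mx; rewrite hE//; apply: integral_ge0 => v _; exact: mule_ge0.
have mh : measurable_fun M h.
  have [||mh _] := @integral_liouville (fun z => (gaussian_density m z.2)%:E * f z)%E.
  - apply: measurable_funTS; apply: emeasurable_funM => //.
    exact: measurableT_comp mgd measurable_snd.
  - by move=> z _; exact: mule_ge0.
  by apply: eq_measurable_fun mh => x /set_mem Mx; rewrite hE.
split; first exact: mh.
transitivity (\int[liouville g]_(z in TM) ((w z)%:E * h z.1))%E; first by [].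
move: h hE h0 mh => h hE h0 mh.
have mhz : measurable_fun TM (fun z => h z.1).
  have mz1 : measurable_fun TM (fun z : E * E => z.1) by exact: measurable_funTS measurable_fst.
  apply: (measurable_comp mM _ mh mz1).
  by move=> _ [z [Mz _] <-].
have [||_ ->] := @integral_liouville (fun z => (w z)%:E * h z.1)%E.
- exact: emeasurable_funM.
- by move=> z [Mz _]; apply: mule_ge0 => //; exact: h0.
have [||_ ->] := @integral_liouville (fun z => (w z)%:E * f z)%E.
- by apply: emeasurable_funM => //; exact: measurable_funTS.
- by move=> z _; exact: mule_ge0.
apply: eq_integral => x /set_mem Mx /=.
have mT := measurable_tangent_space g x.
have cU0 : (0 <= (c * expR (- U x))%:E :> \bar R)%E by rewrite lee_fin mulr_ge0// expR_ge0.
have mgT : measurable_fun (Tx x) (fun v : E => (expR (- (sqnorm v / 2)))%:E).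
  by apply/measurable_EFinP; apply: measurable_funTS; exact: measurable_gauss.
(* The common value of the two fibre integrals: on the left [h x] is constant along the fibre and
   the Gaussian integrates to [c0]; on the right [c0] cancels the normalization of
   [gaussian_density]. *)
transitivity ((c * expR (- U x))%:E * (c0%:E * h x))%E.
  rewrite -(integral_gauss_tangent_space Mx) -ge0_integralZr//; last exact: h0.
  rewrite -ge0_integralZl//; last 2 first.
  - by apply: emeasurable_funM; [exact: mgT|exact: measurable_cst].
  - by move=> v _; apply: mule_ge0; [rewrite lee_fin expR_ge0|exact: h0].
  apply: eq_integral => v _; rewrite muleA; congr (_ * _)%E.
  by rewrite /w expR_hamiltonian mulrA EFinM.
rewrite hE// -ge0_integralZl//; last 3 first.
- by apply: emeasurable_funM; exact: measurable_funTS.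
- by move=> v _; exact: mule_ge0.
- by rewrite lee_fin ltW// gauss_normalization_gt0.
rewrite -ge0_integralZl//; last 2 first.
- apply: emeasurable_funM; first exact: measurable_cst.
  by apply: emeasurable_funM; exact: measurable_funTS.
- move=> v _; apply: mule_ge0; last exact: mule_ge0.
  by rewrite lee_fin ltW// gauss_normalization_gt0.
apply: eq_integral => v _; rewrite !muleA -!EFinM; congr (_%:E * _)%E.
rewrite /w expR_hamiltonian /gaussian_density -/c0; field.
by rewrite gt_eqF// gauss_normalization_gt0.
Qed.

End Canonical.

(** * Invariance of the canonical measure under one iteration *)

Theorem proposition3 (R : realType) (n m : nat)
  (g : 'I_m -> mpoly.mpoly n R)
  (full_rank : forall x : 'cV[R]_n,
     constraint_manifold g x -> \rank (constraint_jacobian g x) = m)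
  (U : 'cV[R]_n -> R)
  (U_diff : forall x : 'cV[R]_n,
     constraint_manifold g x -> differentiable (U : 'cV[R]_n -> R^o) x)
  (U_pos : (0 < \int[@surface_measure R n m]_(x in constraint_manifold g)
                  (expR (- U x))%:E)%E)
  (U_fin : (\int[@surface_measure R n m]_(x in constraint_manifold g)
                  (expR (- U x))%:E < +oo)%E)
  (dt_max rate : R) (dt_max_gt0 : 0 < dt_max) (rate_gt0 : 0 < rate)
  (Phi : R -> 'cV[R]_n * 'cV[R]_n -> 'cV[R]_n * 'cV[R]_n)
  (Phi_rattle : forall (dt : R) (z : 'cV[R]_n * 'cV[R]_n),
     0 < dt <= dt_max -> tangent_bundle g z -> rattle_step g U dt z (Phi dt z))
  (Phi_measurable : measurable_fun (`]0, dt_max] `*` tangent_bundle g)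
     (fun p : R * ('cV[R]_n * 'cV[R]_n) => Phi p.1 p.2))
  (Phi_volume : forall dt : R, 0 < dt <= dt_max ->
     liouville_preserving g (Phi dt))
  (check : bool)
  (reversible : forall (T : R) (z : 'cV[R]_n * 'cV[R]_n),
     0 < T -> tangent_bundle g z ->
     proposal Phi dt_max check T (proposal Phi dt_max check T z) = z) :
  exists mu : probability ('cV[R]_n * 'cV[R]_n)%type R,
    (forall A : set ('cV[R]_n * 'cV[R]_n), measurable A ->
       mu A = ((fine (canonical_weight g U (tangent_bundle g)))^-1%:E
               * canonical_weight g U A)%E) /\
    (forall A : set ('cV[R]_n * 'cV[R]_n), measurable A ->
       (\int[mu]_(z in tangent_bundle g)
          hmc_kernel g U Phi dt_max check rate z A)%E = mu A).
Proof.
pose TM := tangent_bundle g; pose M := constraint_manifold g.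
have mTM : measurable TM := measurable_tangent_bundle g.
have mM : measurable M := measurable_constraint_manifold g.
have mU : measurable_fun M U.
  by apply: measurable_continuous_at => // x /U_diff/differentiable_continuous.
have mH : measurable_fun TM (hamiltonian U) by exact: measurable_hamiltonian.
have Phi_TM dt z : 0 < dt <= dt_max -> TM z -> TM (Phi dt z).
  by move=> dtb /(Phi_rattle dt z dtb)[vh [lr [lv [_ _ Mz _ Cz]]]].
have [lam lamE _] := liouville_mixture full_rank.
pose W := canonical_weight g U TM.
have W_total := canonical_weight_total full_rank mU.
have W0 : (0 < W)%E.
  by rewrite /W W_total mule_gt0// lte_fin gauss_normalization_gt0.
have Wfin : W \is a fin_num.
  rewrite ge0_fin_numE; last exact: ltW.
  by rewrite /W W_total lte_mul_pinfty// lee_fin ltW// gauss_normalization_gt0.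
pose c := (fine W)^-1.
have c_gt0 : 0 < c by rewrite invr_gt0 fine_gt0// W0 ltey_eq Wfin.
have c_ge0 : 0 <= c := ltW c_gt0.
pose w z := c * expR (- hamiltonian U z).
have w_ge0 z : 0 <= w z by rewrite mulr_ge0// expR_ge0.
have mexpH : measurable_fun TM (fun z => expR (- hamiltonian U z)).
  exact: measurable_expR_hamiltonian.
have mw : measurable_fun TM w by exact: measurable_funM.
have [mu0 mu0E mu0_int] := density_measure lam mTM mw w_ge0.
have mu0_weight A : measurable A -> mu0 A = (c%:E * canonical_weight g U A)%E.
  move=> mA; rewrite mu0E /canonical_weight -lamE -ge0_integralZl//.
  - exact: measurableI.
  - by apply/measurable_EFinP; apply: measurable_funS mexpH => //; exact: subIsetr.
have mu0T : mu0 setT = 1%E.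
  rewrite mu0_weight// /canonical_weight setTI.
  have -> : (\int[liouville g]_(z in TM) (expR (- hamiltonian U z))%:E)%E = W.
    by rewrite /W /canonical_weight setIid.
  by rewrite -(fineK Wfin) -EFinM mulVf// gt_eqF// fine_gt0// W0 ltey_eq Wfin.
exists (probability_copy mu0T); split=> A mA; first exact: mu0_weight.
pose ep := exponential_probability rate_gt0.
pose prop := proposal Phi dt_max check.
pose phi (p : R * ('cV[R]_n * 'cV[R]_n)) : R :=
  let a := accept_prob U p.2 (prop p.1 p.2) in
  a * \1_A (prop p.1 p.2) + (1 - a) * \1_A p.2.
pose PT := @positive_time R n m g.
have mPT : measurable PT by exact: measurable_positive_time.
have mprop : measurable_fun PT (fun p => prop p.1 p.2) by exact: measurable_proposal.
have msnd : measurable_fun PT (fun p => p.2) by exact: measurable_funTS measurable_snd.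
have prop_TM T z : 0 < T -> TM z -> TM (prop T z) by exact: tangent_bundle_proposal.
have phi_ge0 p : (0 <= (phi p)%:E)%E.
  rewrite lee_fin addr_ge0// mulr_ge0 ?indicE ?ler0n//.
    by rewrite /accept_prob le_min ler01 expR_ge0.
  by rewrite subr_ge0 /accept_prob ge_min lexx.
have mphi : measurable_fun PT phi.
  have mHp : measurable_fun PT (fun p => hamiltonian U (prop p.1 p.2)).
    by apply: (measurable_comp mTM _ mH mprop) => _ [p [p0 Tp] <-]; exact: prop_TM.
  have mHz : measurable_fun PT (fun p => hamiltonian U p.2).
    by apply: (measurable_comp mTM _ mH msnd) => _ [p [p0 Tp] <-].
  have ma : measurable_fun PT (fun p => accept_prob U p.2 (prop p.1 p.2)).
    apply: measurable_minr; first exact: measurable_cst.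
    by apply: measurableT_comp => //; exact: measurable_funB.
  have m1 : measurable_fun setT (\1_A : _ -> R) by exact: measurable_indic.
  apply: measurable_funD; apply: measurable_funM => //.
  - exact: measurableT_comp m1 mprop.
  - exact: measurable_funB.
  - exact: measurableT_comp m1 msnd.
(* Extension by 0 outside positive durations and the bundle, where nothing is known of the
   measurability of the proposal; Tonelli's theorem needs a function measurable on the whole
   product. *)
pose phiT := (EFin \o phi) \_ PT.
have mphiT : measurable_fun setT phiT.
  by apply/(measurable_restrictT _ mPT); exact/measurable_EFinP.
have phiT0 p : (0 <= phiT p)%E by apply: erestrict_ge0 => q _; exact: phi_ge0.
pose K z := (\int[ep]_T phiT (T, z))%E.
have mK : measurable_fun setT K by exact: measurable_fun_fubini_tonelli_G.
have K0 z : (0 <= K z)%E by apply: integral_ge0 => T _; exact: phiT0.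
have KE z : TM z -> metropolis_kernel U Phi dt_max check rate z A = K z.
  move=> Tz; rewrite /metropolis_kernel integral_mkcond; apply: eq_integral => T _.
  rewrite /phiT !patchE; congr (if _ then _ else _).
  by apply/idP/idP => /set_mem h; apply/mem_set; move: h; rewrite /= in_itv/= andbT;
    [move=> T0; split|case].
pose h x := (\int[tangent_gaussian g x]_(v in tangent_space g x) K (x, v))%E.
have hmcE z : TM z -> hmc_kernel g U Phi dt_max check rate z A = h z.1.
  by move=> [Mz _]; apply: eq_integral_tangent_gaussian => v Tv; exact: KE.
have [mh resample] := resample_velocity full_rank mU c_ge0 mK K0.
have h0 x : (0 <= h x)%E by apply: tangent_gaussian_integral_ge0 => v; exact: K0.
have mhz : measurable_fun TM (fun z => h z.1).
  have mz1 : measurable_fun TM (fun z : 'cV[R]_n * 'cV[R]_n => z.1).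
    exact: measurable_funTS measurable_fst.
  by apply: (measurable_comp mM _ mh mz1) => _ [z [Mz _] <-].
have mu0_intTM (f : 'cV[R]_n * 'cV[R]_n -> \bar R) : measurable_fun TM f ->
    (forall z, TM z -> 0 <= f z)%E ->
    (\int[mu0]_(z in TM) f z = \int[lam]_(z in TM) ((w z)%:E * f z))%E.
  move=> mf f0; rewrite integral_mkcond mu0_int.
  - by apply: eq_integral => z zT; rewrite patchE zT.
  - exact/(measurable_restrictT _ mTM).
  - by move=> z; exact: erestrict_ge0.
transitivity (\int[mu0]_(z in TM) h z.1)%E.
  by apply: eq_integral => z /set_mem Tz; exact: hmcE.
rewrite mu0_intTM// lamE resample -lamE -mu0_int//.
(* The normalized density is absorbed into the measure before exchanging the integrals: the target
   is then a probability measure, hence an admissible factor for Tonelli, which [lam] is not known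
   to be. *)
transitivity (\int[probability_copy mu0T]_z \int[ep]_T phiT (T, z))%E; first by [].
rewrite -(@fubini_tonelli _ _ _ _ _ ep (probability_copy mu0T) phiT)//.
have balance T : 0 < T -> (\int[mu0]_z phiT (T, z) = mu0 A)%E.
  move=> T0; rewrite mu0_int//; last exact: measurableT_comp mphiT (measurable_pair1 T).
  rewrite [RHS](_ : _ = \int[lam]_(z in A `&` TM) (w z)%:E)%E; last by rewrite mu0E.
  have mpT : measurable_fun TM (prop T).
    have mp : measurable_fun TM (fun z : 'cV[R]_n * 'cV[R]_n => (T, z)).
      by apply: measurable_fun_pair_in; [exact: measurable_cst|exact: measurable_id].
    by apply: (measurable_comp mPT _ mprop mp) => _ [z Tz <-].
  rewrite -(@detailed_balance _ _ _ lam TM (prop T) mTM mpT _ _ _ c mH c_ge0 _ A mA).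
  - apply: eq_integral => z zT; rewrite /phiT patchE mem_set//.
    by split => //=; exact: set_mem.
  - by move=> z; exact: prop_TM.
  - by move=> B mB BT; rewrite lamE; exact: liouville_proposal.
  - by move=> z; exact: reversible.
(* At nonpositive [T] the extended integrand is 0, which matches the restriction of the integral to
   the open half-line. *)
transitivity (\int[ep]_(T in `]0%R, +oo[) cst (mu0 A) T)%E.
  rewrite [RHS]integral_mkcond; apply: eq_integral => T _; rewrite patchE.
  case: ifPn => [/set_mem|/negP nT]; first by rewrite /= in_itv/= andbT => /balance.
  rewrite integral0_eq// => z _; rewrite /phiT patchE memNset// => -[/= T0 _].
  by apply: nT; apply/mem_set; rewrite /= in_itv/= T0.
rewrite integral_cst//.
rewrite [X in (_ * X)%E](_ : _ = 1%E) ?mule1//.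
exact: exponential_prob_gt0.
Qed.
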